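(* Let $1<p<5$ and let $u\in C(\mathbb{R}^+,H^1(\mathbb{R}))$ be a (complex-valued) solution of the nonlinear Schrödinger equation $$ iu_t+u_{xx}\pm|u|^{p-1}u=0,\qquad (t,x)\in\mathbb{R}^+\times\mathbb{R},$$ (either sign) with initial data $u(0,\cdot)=u_0$ satisfying $\|u_0\|_{H^1(\mathbb{R})}<\infty$. Then, for every $\delta>0$ and every $\mu\in C^1(\mathbb{R})$ satisfying $\mu(t)\gtrsim t\log(t)^{1+\delta}$, $$\lim_{t\to\infty}\|u(t)\|_{L^2(|x|\sim\mu(t))}=0 .$$
   Context: $\mathbb{R}^+=[0,\infty)$. Notation: $\mu(t)\gtrsim b(t)$ means that there is a constant $c>0$ with $\mu(t)\ge c\,b(t)$ for $t\ge2$. $\|\cdot\|_{L^2(|x|\sim\mu(t))}$ denotes the $L^2$-norm over the region $\{x\in\mathbb{R}: c_1\mu(t)\le|x|\le c_2\mu(t)\}$, where $0<c_1<c_2$ are arbitrary fixed constants (independent of $t$). *)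

(* Defs.v *)
From HB Require Import structures.
From mathcomp Require Import all_boot all_order all_algebra.
From mathcomp Require Import all_classical all_reals all_analysis.
From mathcomp Require Export complex.

Set Implicit Arguments.
Unset Strict Implicit.
Unset Printing Implicit Defensive.

Import Order.TTheory GRing.Theory Num.Theory.
Import numFieldNormedType.Exports.
Import ComplexField.Normc.

Local Open Scope classical_set_scope.
Local Open Scope ring_scope.

Definition cintegral (R : realType) (f : R -> R[i]) : R[i] :=
  (Rintegral (@lebesgue_measure R) setT (fun x => complex.Re (f x)) +i*
   Rintegral (@lebesgue_measure R) setT (fun x => complex.Im (f x)))%C.

(* Elements of L^2 are represented by Borel functions, not by classes; the
   notions below do not depend on the representative. *)
Definition L2 (R : realType) (f : R -> R[i]) : Prop :=
  ((fun x => complex.Re (f x)) \in Lfun (@lebesgue_measure R) 2%:E) /\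
  ((fun x => complex.Im (f x)) \in Lfun (@lebesgue_measure R) 2%:E).

Definition L2norm (R : realType) (D : set R) (f : R -> R[i]) : \bar R :=
  'N[@lebesgue_measure R]_2%:E[(fun x => (normc (f x))%:E) \_ D].

Definition test_function (R : realType) (phi : R -> R) : Prop :=
  (forall n x, derivable (derive1n n phi) x 1) /\
  compact (closure [set x | phi x != 0]).

(* g in L^2 is the distributional derivative of f. *)
Definition is_weak_derivative (R : realType) (f g : R -> R[i]) : Prop :=
  L2 g /\
  forall phi : R -> R, test_function phi ->
    cintegral (fun x => f x * (derive1 phi x)%:C%C) =
    - cintegral (fun x => g x * (phi x)%:C%C).

Definition H1 (R : realType) (f : R -> R[i]) : Prop :=
  L2 f /\ exists g, is_weak_derivative f g.

(* A weak derivative is unique up to a null set; it is the zero function by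
   convention when f has none. *)
Definition wderiv (R : realType) (f : R -> R[i]) : R -> R[i] :=
  xget (fun=> 0) [set g | is_weak_derivative f g].

(* Meaningful for f in H^1 only. *)
Definition H1norm (R : realType) (f : R -> R[i]) : \bar R :=
  ((L2norm setT f ^+ 2 + L2norm setT (wderiv f) ^+ 2) `^ 2^-1)%E.

Definition continuous_H1 (R : realType) (u : R -> R -> R[i]) : Prop :=
  (forall t, 0 <= t -> H1 (u t)) /\
  (forall t, 0 <= t ->
    H1norm (fun x => u s x - u t x) @[s --> within [set s | 0 <= s] (nbhs t)]
      --> 0%E).

(* Bilinear (no conjugation), as for the duality between H^{-1} and H^1. *)
Definition pairing (R : realType) (f g : R -> R[i]) : R[i] :=
  cintegral (fun x => f x * g x).

Definition is_cderive (R : realType) (f : R -> R[i]) (t : R) (d : R[i]) :=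
  is_derive t 1 (fun s => complex.Re (f s)) (complex.Re d) /\
  is_derive t 1 (fun s => complex.Im (f s)) (complex.Im d).

Definition power_nonlinearity (R : realType) (p : R) (z : R[i]) : R[i] :=
  ((normc z `^ (p - 1))%:C * z)%C.

(* i u_t + u_xx + eps |u|^{p-1} u = 0 for t > 0, as an identity in H^{-1}:
   every term is paired with an arbitrary v in H^1, where u_xx is the
   functional v |-> - \int u_x v_x. *)
Definition solves_NLS (R : realType) (eps p : R) (u : R -> R -> R[i]) : Prop :=
  forall (t : R) (v : R -> R[i]), 0 < t -> H1 v ->
    exists2 d : R[i], is_cderive (fun s => pairing (u s) v) t d &
      'i%C * d - pairing (wderiv (u t)) (wderiv v)
      + eps%:C%C * pairing (fun x => power_nonlinearity p (u t x)) v = 0.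

(* Main.v *)
Require Import Defs.
From HB Require Import structures.
From mathcomp Require Import all_boot all_order all_algebra.
From mathcomp Require Import all_classical all_reals all_analysis.
From mathcomp Require Import measurable_realfun ring lra complex.
Import Order.TTheory GRing.Theory Num.Theory.
Import numFieldNormedType.Exports.
Local Open Scope classical_set_scope.
Local Open Scope ring_scope.

(* Let V(t) be the integral of phi(x / rho) |u(t, x)|^2, where phi is a smooth
   cutoff vanishing near the origin and equal to 1 for |x| >= 1.  The virial
   identity bounds |V'| by C ||u_x(t)|| ||u(t)|| / rho.  Mass and energy are
   conserved and p < 5, so by Gagliardo-Nirenberg ||u_x(t)|| is bounded and
   V(T) <= V(1) + C' T / rho.  With rho = c1 mu(T), the first term is a tail of
   |u(1)|^2 and T / mu(T) tends to 0.

   Energy conservation for solutions in H^1 needs no regularization.  With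
   B(s, t) = Im int u(s) conj(u(t)), the equation gives the derivative of
   t |-> B(t, t + h): the kinetic terms cancel exactly, and Young's inequality
   together with the local Lipschitz continuity of the nonlinearity identifies
   the rest with -+ (p-1)/(p+1) (P(t + h) - P(t)), P(t) = int |u|^(p+1), up to
   O(||u(t + h) - u(t)||^2) = o(h).  Dividing by h and letting h tend to 0
   gives that the energy has derivative 0. *)

(** * Real derivatives *)

Section real_derivative.
Context {R : realType}.
Implicit Types (f : R -> R) (t d : R).

(** For u merely in H^1, u_t lies in H^{-1} and cannot serve as a test function, so the energy is
    not differentiated directly. The equation at one time may however be tested with u at another
    time, and the energy is read off from the first-order behaviour in h of B(t, t + h), which
    vanishes at h = 0. The estimate ||u(t + h) - u(t)||^2 = o(h) comes from testing as well: u_t is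
    bounded in H^{-1}, and the increment used as test function is small in H^1. The difference P(t +
    h) - P(t) is removed by adding to B a multiple of Q(t + h) - Q(t), with Q a primitive of P. The
    equation is given for t > 0, so conserved quantities are compared with their values at time 1.
    The argument runs in an abstract semi-inner product space; semi, since elements of L^2 are
    functions and not classes. The Sobolev theory on the line is rebuilt from Lebesgue points and
    from mollifiers that are derivatives of a smooth step; the same step gives the cutoff phi. *)

Lemma is_derive_littleoP f t d :
  is_derive t 1 f d <->
  forall e, 0 < e -> \forall k \near 0, `|f (k + t) - f t - d * k| <= e * `|k|.
Proof.
split=> [[df dE] e e0|h].
- have /cvgrPdist_le/(_ e e0) : (fun k => k^-1 *: ((f \o shift t) (k *: 1) - f t)) @ 0^' --> d.
    by rewrite -dE.
  rewrite near_withinE.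
  apply: filterS => k hk; have [->|k0] := eqVneq k 0.
    by rewrite add0r subrr mulr0 subr0 normr0 mulr0.
  move: (hk k0); rewrite /= [k%:A]mulr1 (_ : _ *: _ = k^-1 * (f (k + t) - f t))//.
  rewrite -ler_pdivrMr ?normr_gt0// -normfV -normrM -normrN.
  congr (`|_| <= _). by field.
- suff H : (fun k => k^-1 *: ((f \o shift t) (k *: 1) - f t)) @ 0^' --> d.
    by apply: DeriveDef; [apply/cvg_ex; exists d|exact: cvg_lim].
  apply/cvgrPdist_le => e e0; rewrite near_withinE.
  have {h} := h e e0; apply: filterS => k hk k0.
  rewrite /= [k%:A]mulr1 (_ : _ *: _ = k^-1 * (f (k + t) - f t))// -normrN.
  rewrite [X in `|X|](_ : _ = (f (k + t) - f t - d * k) / k); last by field.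
  by rewrite normrM normfV ler_pdivrMr ?normr_gt0.
Qed.

(** The endpoints are unordered because increments of either sign occur below. *)
Lemma MVT_minmax f f' (a b : R) :
  (forall x, Num.min a b <= x <= Num.max a b -> is_derive x 1 f (f' x)) ->
  exists2 c, Num.min a b <= c <= Num.max a b & f b - f a = f' c * (b - a).
Proof.
wlog ab : a b / a <= b => [wl|].
  have /orP[|ba] := le_total a b; first exact: wl.
  rewrite minC maxC => /(wl _ _ ba)[c cab fE]; exists c => //.
  by rewrite -opprB fE; ring.
rewrite min_l// max_r// => h.
have [x||c] := @MVT_segment R f f' a b ab; last by exists c.
- by rewrite in_itv/= => /andP[/ltW ax /ltW xb]; apply: h; rewrite ax xb.
- by apply: derivable_within_continuous => x /h -[].
Qed.

Lemma eq_of_is_derive0 f (a b : R) : 0 < a -> 0 < b ->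
  (forall t, 0 < t -> is_derive t 1 f 0) -> f a = f b.
Proof.
move=> a0 b0 h; have [x /andP[xm _]|c _] := @MVT_minmax f (fun=> 0) a b.
  by apply: h; rewrite (lt_le_trans _ xm)// lt_min a0.
by rewrite mul0r => /subr0_eq.
Qed.

Lemma minmax_dist (a b c : R) : Num.min a b <= c <= Num.max a b ->
  `|c - a| <= `|b - a|.
Proof.
have [ab|/ltW ba] := leP a b => /andP[ac cb].
  by rewrite !ger0_norm ?subr_ge0// lerD2r.
by rewrite !ler0_norm ?subr_le0// lerN2 lerD2r.
Qed.

Lemma is_derive_affine a b t : is_derive t 1 (fun x => a * x + b) a.
Proof.
apply/is_derive_littleoP => e e0; apply/nbhs_ballP; exists 1 => //= h _.
rewrite (_ : _ - _ = 0); last by ring.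
by rewrite normr0 mulr_ge0 // ltW.
Qed.

(** The increment is split along the first variable, where the mean value theorem and the continuity
    of [B1] apply, and along the second, where differentiability at the single point [t + h] is
    enough. *)
Lemma is_derive_diagonal (B B1 : R -> R -> R) (B2 t h : R) :
  (\forall s \near t & r \near (t + h), is_derive (s : R) 1 (B^~ r) (B1 s r)) ->
  is_derive (t + h) 1 (B t) B2 ->
  (forall e, 0 < e -> \forall s \near t & r \near (t + h), `|B1 s r - B1 t (t + h)| <= e) ->
  is_derive t 1 (fun t => B t (t + h)) (B1 t (t + h) + B2).
Proof.
move=> dB1 /is_derive_littleoP dB2 cB1; apply/is_derive_littleoP => e e0.
have e20 : 0 < e / 2 by rewrite divr_gt0.
have [[P Q]/= [tP thQ] PQ] := dB1.
have [[P' Q']/= [tP' thQ'] PQ'] := cB1 _ e20.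
have [d /= d0 dP] : nbhs_ball t (P `&` P') by apply/nbhs_ballP; exact: filterI.
have [d' /= d'0 dQ] : nbhs_ball (t + h) (Q `&` Q').
  by apply/nbhs_ballP; exact: filterI.
near=> k.
have kd : `|k| < d by near: k; exact: (@nbhs0_lt _ R^o).
have kd' : `|k| < d' by near: k; exact: (@nbhs0_lt _ R^o).
have [Qk Q'k] : (Q `&` Q') (k + (t + h)).
  by apply: dQ; rewrite /ball/= distrC addrK.
have H x : Num.min t (k + t) <= x <= Num.max t (k + t) -> (P `&` P') x.
  move=> /minmax_dist; rewrite addrK => xk; apply: dP.
  by rewrite /ball/= distrC (le_lt_trans xk).
have [x /H[Px _]|c /H[Pc P'c]] :=
    @MVT_minmax (B^~ (k + (t + h))) (B1^~ (k + (t + h))) t (k + t).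
  exact: (PQ (x, _)).
rewrite addrK => cE.
have -> : B (k + t) (k + t + h) - B t (t + h) - (B1 t (t + h) + B2) * k =
   (B1 c (k + (t + h)) - B1 t (t + h)) * k + (B t (k + (t + h)) - B t (t + h) - B2 * k).
  rewrite mulrBl -cE -[k + t + h]addrA; ring.
rewrite (le_trans (ler_normD _ _))// [e]splitr [leRHS]mulrDl lerD//.
  by rewrite normrM ler_wpM2r//; exact: (PQ' (c, _)).
by near: k; exact: dB2.
Unshelve. all: by end_near. Qed.

Lemma continuous_antiderivative (f : R -> R) (a : R) : continuous f ->
  exists F : R -> R, forall x, a < x -> is_derive x 1 F (f x).
Proof.
move=> cf; exists (fun x => \int[lebesgue_measure]_(t in `[a, x]) f t).
move=> x ax.
have xx1 : x < x + 1 by rewrite ltrDl.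
have [|dF FE] := @continuous_FTC1_closed R f a x _ xx1 _ ax (cf x).
  apply: continuous_compact_integrable; first exact: segment_compact.
  exact: continuous_subspaceT.
by apply: DeriveDef; rewrite -?derive1E.
Qed.

End real_derivative.

(** * Energy conservation in a semi-inner product space *)

Section semi_inner_product.
Context {R : realType} {V : lmodType R} {ip : V -> V -> R}.
Hypotheses (ipC : forall v w, ip v w = ip w v)
  (ipDl : forall v w x, ip (v + w) x = ip v x + ip w x)
  (ipZl : forall k v w, ip (k *: v) w = k * ip v w)
  (ip_ge0 : forall v, 0 <= ip v v).

Implicit Types (a b s t r e h : R) (v w x y : V).

Definition seminorm v := Num.sqrt (ip v v).

Lemma ipNl v w : ip (- v) w = - ip v w.
Proof. by rewrite -scaleN1r ipZl mulN1r. Qed.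

Lemma ipNr v w : ip v (- w) = - ip v w.
Proof. by rewrite ipC ipNl ipC. Qed.

Lemma ipBl v w x : ip (v - w) x = ip v x - ip w x.
Proof. by rewrite ipDl ipNl. Qed.

Lemma ipDr v w x : ip v (w + x) = ip v w + ip v x.
Proof. by rewrite ipC ipDl ![ip _ v]ipC. Qed.

Lemma ipBr v w x : ip v (w - x) = ip v w - ip v x.
Proof. by rewrite ipDr ipNr. Qed.

Lemma ip_sqr v : ip v v = seminorm v ^+ 2.
Proof. by rewrite sqr_sqrtr. Qed.

Lemma seminorm_ge0 v : 0 <= seminorm v.
Proof. exact: sqrtr_ge0. Qed.

Lemma cauchy_schwarz v w : `|ip v w| <= seminorm v * seminorm w.
Proof.
have q k : 0 <= ip v v + 2 * k * ip v w + k ^+ 2 * ip w w.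
  have := ip_ge0 (v + k *: w).
  rewrite ipDl !ipDr !ipZl [ip v (k *: w)]ipC !ipZl [ip w v]ipC [ip w (k *: w)]ipC ipZl.
  by congr (_ <= _); ring.
rewrite -sqrtr_sqr -sqrtrM// ler_sqrt ?mulr_ge0//.
have [w0|w0] := eqVneq (ip w w) 0.
  have [->|vw0] := eqVneq (ip v w) 0; first by rewrite expr0n/= mulr_ge0.
  (* Here [q] is affine in [k], and this [k] gives it the value -1. *)
  have := q (- (ip v v + 1) / (2 * ip v w)); rewrite w0.
  have -> : 2 * (- (ip v v + 1) / (2 * ip v w)) * ip v w = - (ip v v + 1).
    by field.
  by rewrite mulr0 addr0; have := ip_ge0 v; lra.
have wp : 0 < ip w w by rewrite lt_neqAle eq_sym w0/=.
have := q (- ip v w / ip w w); rewrite -(pmulr_lge0 _ wp).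
have -> : (ip v v + 2 * (- ip v w / ip w w) * ip v w +
   (- ip v w / ip w w) ^+ 2 * ip w w) * ip w w = ip v v * ip w w - ip v w ^+ 2.
  by field.
by rewrite subr_ge0.
Qed.

Lemma ip_dist v v' w w' : `|ip v w - ip v' w'| <=
  seminorm (v - v') * seminorm (w - w') + seminorm (v - v') * seminorm w' +
  seminorm v' * seminorm (w - w').
Proof.
have -> : ip v w - ip v' w' = ip (v - v') (w - w') + ip (v - v') w' + ip v' (w - w').
  by rewrite !ipBl !ipBr; ring.
rewrite !(le_trans (ler_normD _ _))// !lerD// ?cauchy_schwarz//.
by rewrite (le_trans (ler_normD _ _))// lerD// cauchy_schwarz.
Qed.

Lemma cvg_ip {T : Type} {F : set_system T} {FF : Filter F} (X Y : T -> V) x y :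
  seminorm (X t - x) @[t --> F] --> 0 -> seminorm (Y t - y) @[t --> F] --> 0 ->
  ip (X t) (Y t) @[t --> F] --> ip x y.
Proof.
move=> Xx Yy; apply/subr_cvg0/norm_cvg0P.
have H : seminorm (X t - x) * seminorm (Y t - y) + seminorm (X t - x) * seminorm y +
    seminorm x * seminorm (Y t - y) @[t --> F] --> 0 * 0 + 0 * seminorm y + seminorm x * 0.
  by apply: cvgD; [apply: cvgD; [exact: cvgM|exact: cvgMl]|exact: cvgMr].
rewrite !(mul0r, mulr0, addr0) in H.
apply: (squeeze_cvgr _ (cvg_cst 0) H); near=> t.
by rewrite normr_ge0 ip_dist.
Unshelve. all: by end_near. Qed.

Lemma seminormN v : seminorm (- v) = seminorm v.
Proof. by rewrite /seminorm ipNl ipNr opprK. Qed.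

Lemma seminormD v w : seminorm (v + w) <= seminorm v + seminorm w.
Proof.
rewrite -(ler_pXn2r (_ : 0 < 2)%N) ?nnegrE ?addr_ge0 ?seminorm_ge0//.
rewrite -ip_sqr ipDl !ipDr [ip w v]ipC [leRHS]sqrrD -!ip_sqr.
have := le_trans (ler_norm _) (cauchy_schwarz v w); lra.
Qed.

Lemma seminormB v w : seminorm (v - w) <= seminorm v + seminorm w.
Proof. by rewrite -(seminormN w) seminormD. Qed.

Lemma near_seminorm (X : R -> V) t e : 0 < e ->
  seminorm (X s - X t) @[s --> t] --> 0 -> \forall s \near t, seminorm (X s - X t) <= e.
Proof.
move=> e0 /cvgr0_norm_le /(_ _ e0); apply: filterS => s.
by rewrite ger0_norm ?seminorm_ge0.
Qed.

(** [J] stands for multiplication by i, [H v v'] for the relation that v' is the weak derivative of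
    v, and [U], [D], [N] for the solution, its gradient and |u|^(p-1) u. With [ip v w] = Re int v
    conj(w), hypothesis [dU] is the weak form of u_t = i (u_xx + eps N). *)
Context {J : V -> V} {H : V -> V -> Prop} {U D N : R -> V} {eps p : R}.
Hypotheses (JB : forall v w, J (v - w) = J v - J w)
  (JJ : forall v, J (J v) = - v)
  (ipJ : forall v w, ip (J v) w = - ip v (J w))
  (HB : forall v v' w w', H v v' -> H w w' -> H (v - w) (v' - w'))
  (HJ : forall v v', H v v' -> H (J v) (J v'))
  (HU : forall t : R, 0 < t -> H (U t) (D t))
  (dU : forall (t : R) w w', 0 < t -> H w w' ->
    is_derive t 1 (fun s => ip (U s) w) (ip (D t) (J w') - eps * ip (N t) (J w)))
  (cU : forall t : R, 0 < t -> seminorm (U s - U t) @[s --> t] --> 0)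
  (cD : forall t : R, 0 < t -> seminorm (D s - D t) @[s --> t] --> 0)
  (cN : forall t : R, 0 < t -> seminorm (N s - N t) @[s --> t] --> 0).

Lemma seminormJ v : seminorm (J v) = seminorm v.
Proof. by rewrite /seminorm ipJ JJ ipNr opprK. Qed.

Lemma cvg_ip2 (X Y : R -> V) t r e : 0 < e ->
  seminorm (X s - X t) @[s --> t] --> 0 -> seminorm (Y s - Y r) @[s --> r] --> 0 ->
  \forall s \near t & s' \near r, `|ip (X s) (Y s') - ip (X t) (Y r)| <= e.
Proof.
move=> e0 cX cY.
have : ip (X z.1) (Y z.2) @[z --> (t, r)] --> ip (X t) (Y r).
  apply: cvg_ip.
    exact: (cvg_comp _ _ cvg_fst cX).
  exact: (cvg_comp _ _ cvg_snd cY).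
move=> /cvgrPdist_le/(_ _ e0); apply: filterS => z.
by rewrite distrC.
Qed.

(** The symmetry hypothesis holds when [W] comes from [U] by a self-adjoint operator, later
    multiplication by a real weight. It makes the two partial derivatives of the two-time form
    equal, whence the factor 2; the form is differentiated along the diagonal with shift 0. *)
Lemma is_derive_virial (W W' : R -> V) t : 0 < t ->
  (forall s, 0 < s -> H (W s) (W' s)) ->
  (forall s r, ip (U s) (W r) = ip (U r) (W s)) ->
  seminorm (W s - W t) @[s --> t] --> 0 ->
  seminorm (W' s - W' t) @[s --> t] --> 0 ->
  is_derive t 1 (fun s => ip (U s) (W s))
    (2 * (ip (D t) (J (W' t)) - eps * ip (N t) (J (W t)))).
Proof.
move=> t0 HW WC cW cW'.
have JW (X : R -> V) : seminorm (X s - X t) @[s --> t] --> 0 ->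
    seminorm (J (X s) - J (X t)) @[s --> t] --> 0.
  by under [in X in _ -> X]eq_fun do rewrite -JB seminormJ.
pose B1 s r := ip (D s) (J (W' r)) - eps * ip (N s) (J (W r)).
have := @is_derive_diagonal R (fun s r => ip (U s) (W r)) B1 (B1 t t) t 0.
rewrite addr0 => diag.
rewrite (_ : (fun s => ip (U s) (W s)) = fun s => ip (U s) (W (s + 0))); last first.
  by apply/funext => s; rewrite addr0.
rewrite mulr_natl mulr2n; apply: diag.
- exists ([set s | 0 < s], [set s | 0 < s]) => /=.
    by split; exact: lt_nbhsr.
  by move=> [s r]/= [s0 r0]; apply: dU => //; exact: HW.
- by under eq_fun do rewrite WC; apply: dU => //; exact: HW.
move=> e e0.
have e1 : 0 < e / (1 + `|eps|) by rewrite divr_gt0// ltr_pwDl.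
have := cvg_ip2 _ _ _ _ _ e1 (cD _ t0) (JW _ cW'); have := cvg_ip2 _ _ _ _ _ e1 (cN _ t0) (JW _ cW).
apply: filterS2 => -[s r]/= h1 h2.
have -> : B1 s r - B1 t t = (ip (D s) (J (W' r)) - ip (D t) (J (W' t))) -
   eps * (ip (N s) (J (W r)) - ip (N t) (J (W t))) by rewrite /B1; ring.
rewrite (le_trans (ler_normB _ _))// normrM.
have -> : e = e / (1 + `|eps|) + `|eps| * (e / (1 + `|eps|)).
  by field; rewrite gt_eqF// ltr_pwDl.
by rewrite lerD// ler_wpM2l.
Qed.

Lemma ball_minmax (t r a b x : R) : ball t r a -> ball t r b ->
  Num.min a b <= x <= Num.max a b -> ball t r x.
Proof.
rewrite /ball/= !ltr_distlC ge_min le_max.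
by move=> /andP[ra ar] /andP[rb br] /andP[/orP[] h1 /orP[] h2]; apply/andP; split; lra.
Qed.

(* Testing the equation with the increment itself: the increments of [U] are
   [o(|b - a|^(1/2))]. *)
Lemma ip_increment t e : 0 < t -> 0 < e ->
  \forall a \near t & b \near t, ip (U b - U a) (U b - U a) <= e * `|b - a|.
Proof.
move=> t0 e0.
(* Near t, [K] bounds ||D c|| + |eps| ||N c||, while the increments of [U] and [D] have norm at most
   [2 * k]; the product of the two bounds is [e]. *)
pose K := seminorm (D t) + `|eps| * seminorm (N t) + (1 + `|eps|).
have K0 : 0 < K by rewrite ltr_wpDl ?ltr_pwDl// addr_ge0 ?seminorm_ge0// mulr_ge0 ?seminorm_ge0.
pose k := e / (2 * K).
have k0 : 0 < k by rewrite divr_gt0// mulr_gt0.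
pose G := [set s | 0 < s /\ [/\ seminorm (U s - U t) <= k, seminorm (D s - D t) <= k,
  seminorm (D s - D t) <= 1 & seminorm (N s - N t) <= 1]].
have tG : \forall s \near t, G s.
  near=> s; split; first by near: s; exact: lt_nbhsr.
  split; near: s.
  - exact: near_seminorm k0 (cU _ t0).
  - exact: near_seminorm k0 (cD _ t0).
  - exact: near_seminorm ltr01 (cD _ t0).
  - exact: near_seminorm ltr01 (cN _ t0).
have /nbhs_ballP[d /= d0 dG] := tG.
have diff (X : R -> V) a b : seminorm (X a - X t) <= k -> seminorm (X b - X t) <= k ->
    seminorm (X b - X a) <= 2 * k.
  move=> Xa Xb; rewrite (_ : X b - X a = (X b - X t) - (X a - X t)); last first.
    by rewrite opprB addrA subrK.
  by rewrite (le_trans (seminormB _ _))// mulr_natl mulr2n lerD.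
have bnd (X : R -> V) a : seminorm (X a - X t) <= 1 -> seminorm (X a) <= seminorm (X t) + 1.
  move=> Xa; rewrite -[X a](subrK (X t)) addrC.
  by rewrite (le_trans (seminormD _ _))// lerD.
exists (ball t d, ball t d); first by split; exact: nbhsx_ballx.
move=> [a b] /= [ta tb].
have [a0 [Ua Da _ _]] := dG _ ta; have [b0 [Ub Db _ _]] := dG _ tb.
have Hw : H (U b - U a) (D b - D a) by apply: HB; exact: HU.
(* The increment is frozen as test vector; the mean value theorem in the remaining time variable
   produces the factor [b - a]. *)
have [x xab|c cab] := @MVT_minmax R (fun s => ip (U s) (U b - U a))
    (fun s => ip (D s) (J (D b - D a)) - eps * ip (N s) (J (U b - U a))) a b.
  by apply: dU => //; have [] := dG _ (ball_minmax _ _ _ _ _ ta tb xab).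
rewrite -ipBl => ->; rewrite (le_trans (ler_norm _))// normrM ler_wpM2r//.
have [c0 [_ _ Dc Nc]] := dG _ (ball_minmax _ _ _ _ _ ta tb cab).
rewrite (le_trans (ler_normB _ _))// normrM.
have := cauchy_schwarz (D c) (J (D b - D a)); rewrite seminormJ => h1.
have := cauchy_schwarz (N c) (J (U b - U a)); rewrite seminormJ => h2.
have -> : e = (seminorm (D t) + 1) * (2 * k) + `|eps| * ((seminorm (N t) + 1) * (2 * k)).
  by rewrite /k /K; field; rewrite gt_eqF.
rewrite lerD// ?ler_wpM2l//.
  by rewrite (le_trans h1)// ler_pM ?seminorm_ge0 ?bnd ?diff.
by rewrite (le_trans h2)// ler_pM ?seminorm_ge0 ?bnd ?diff.
Unshelve. all: by end_near. Qed.

Hypotheses (p1 : 1 < p)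
  (monoN : forall t : R, 0 < t -> exists L : R, \forall s \near t & r \near t,
    ip (N s - N r) (U s - U r) <= L * ip (U s - U r) (U s - U r))
  (youngN : forall s r : R, 0 < s -> 0 < r -> ip (N s) (U r) <=
    p / (p + 1) * ip (N s) (U s) + (p + 1)^-1 * ip (N r) (U r)).

(** Twice the usual energy, since [ip (N t) (U t)] is int |u|^(p+1). *)
Definition energy t := ip (D t) (D t) - eps * (2 / (p + 1)) * ip (N t) (U t).

(* Young's inequality bounds each product from above, and one-sided
   Lipschitz continuity bounds their sum from below. *)
Lemma ip_N_asym s r L : 0 < s -> 0 < r ->
  ip (N s - N r) (U s - U r) <= L * ip (U s - U r) (U s - U r) ->
  `|ip (N s) (U r) - ip (N r) (U s) + (p - 1) / (p + 1) *
    (ip (N r) (U r) - ip (N s) (U s))| <= L * ip (U s - U r) (U s - U r).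
Proof.
move=> s0 r0; rewrite [X in X <= _ -> _](_ : _ = ip (N s) (U s) + ip (N r) (U r)
  - ip (N s) (U r) - ip (N r) (U s)); last by rewrite !ipBl !ipBr; ring.
have p10 : p + 1 != 0 by rewrite gt_eqF// addr_gt0// (lt_trans _ p1).
have := youngN _ _ s0 r0; have := youngN _ _ r0 s0.
have -> : p / (p + 1) = 1 - (p + 1)^-1 by field.
have -> : (p - 1) / (p + 1) = 1 - 2 * (p + 1)^-1 by field.
move: (L * _) (p + 1)^-1 => l q.
move=> h1 h2 h3; rewrite ler_norml; apply/andP; split; lra.
Qed.

(* The kinetic terms of the two partial derivatives cancel. *)
Lemma is_derive_ip_J t h : 0 < t -> 0 < t + h ->
  is_derive t 1 (fun s => ip (U s) (J (U (s + h))))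
   (eps * (ip (N t) (U (t + h)) - ip (N (t + h)) (U t))).
Proof.
move=> t0 th0.
pose B1 s r := eps * ip (N s) (U r) - ip (D s) (D r).
rewrite (_ : eps * _ = B1 t (t + h) - B1 (t + h) t); last first.
  by rewrite /B1 [ip (D (t + h)) _]ipC; ring.
have dB s r : 0 < s -> 0 < r -> is_derive s 1 (fun s => ip (U s) (J (U r))) (B1 s r).
  move=> s0 r0; rewrite (_ : B1 s r = ip (D s) (J (J (D r))) - eps * ip (N s) (J (J (U r)))).
    exact: dU _ _ _ s0 (HJ _ _ (HU _ r0)).
  by rewrite !JJ !ipNr /B1; ring.
apply: (@is_derive_diagonal R (fun s r => ip (U s) (J (U r))) B1) => //.
- exists ([set s | 0 < s], [set s | 0 < s]) => /=.
    by split; exact: lt_nbhsr.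
  by move=> [s r]/= [s0 r0]; exact: dB.
- rewrite (_ : (fun r => _) = - (fun r => ip (U r) (J (U t)))).
    exact: is_deriveN (dB _ _ th0 t0).
  by apply/funext => r; rewrite -[RHS]ipJ ipC.
move=> e e0.
have e1 : 0 < e / (1 + `|eps|) by rewrite divr_gt0// ltr_pwDl.
have := cvg_ip2 _ _ _ _ _ e1 (cD _ t0) (cD _ th0).
have := cvg_ip2 _ _ _ _ _ e1 (cN _ t0) (cU _ th0).
apply: filterS2 => -[s r]/= h1 h2.
have -> : B1 s r - B1 t (t + h) = eps * (ip (N s) (U r) - ip (N t) (U (t + h))) -
   (ip (D s) (D r) - ip (D t) (D (t + h))) by rewrite /B1; ring.
rewrite (le_trans (ler_normB _ _))// normrM.
have -> : e = `|eps| * (e / (1 + `|eps|)) + e / (1 + `|eps|).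
  by field; rewrite gt_eqF// ltr_pwDl.
by rewrite lerD// ler_wpM2l.
Qed.

(** Clamping the time at [tau] gives a function continuous on the whole line, as
    [continuous_antiderivative] requires, and equal to the potential from [tau] on. *)
Lemma continuous_ip_N (tau : R) : 0 < tau ->
  continuous (fun t => ip (N (Num.max t tau)) (U (Num.max t tau))).
Proof.
move=> tau0 t; pose g (s : R) := Num.max s tau.
have g0 : 0 < g t by rewrite lt_max tau0 orbT.
have cg : g s @[s --> t] --> g t by apply: continuous_max => //; exact: cvg_cst.
apply: cvg_ip.
  exact: (cvg_comp _ _ cg (cN _ g0)).
exact: (cvg_comp _ _ cg (cU _ g0)).
Qed.

(* [M h] below is [h * energy + o(h)], and its time derivative is [o(h)]. *)
Lemma is_derive_energy t : 0 < t -> is_derive t 1 energy 0.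
Proof.
move=> t0.
have p10 : p + 1 != 0 by rewrite gt_eqF// addr_gt0// (lt_trans _ p1).
pose P s := ip (N s) (U s); pose c := (p - 1) / (p + 1).
(* All times considered below stay above [t / 2], where the clamped potential is the true one. *)
have t20 : 0 < t / 2 by rewrite divr_gt0.
have [Q dQ'] := continuous_antiderivative _ 0 (continuous_ip_N _ t20).
have {}dQ' s : t / 2 < s -> is_derive s 1 Q (P s).
  move=> ts; have s0 : 0 < s by rewrite (lt_trans _ ts)// divr_gt0.
  by have := dQ' _ s0; rewrite max_l// ltW.
have [L LN] := monoN _ t0.
(* The correction by [Q] makes the time derivative equal to [eps] times the quantity estimated in
   [ip_N_asym]. *)
pose M h s := ip (U s) (J (U (s + h))) + eps * c * (Q (s + h) - Q s).
have dM h s : t / 2 < s -> t / 2 < s + h -> is_derive s 1 (M h)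
   (eps * (ip (N s) (U (s + h)) - ip (N (s + h)) (U s) + c * (P (s + h) - P s))).
  move=> ts tsh.
  have s0 : 0 < s by rewrite (lt_trans _ ts)// divr_gt0.
  have sh0 : 0 < s + h by rewrite (lt_trans _ tsh)// divr_gt0.
  have d1 := is_derive_ip_J _ _ s0 sh0.
  have d2 : is_derive s 1 (fun s => Q (s + h)) (P (s + h) * 1).
    apply: (@is_derive1_comp _ Q (fun s => s + h)); first exact: dQ'.
    exact: is_derive_shift.
  have d3 := is_deriveD d1 (is_deriveZ (eps * c) (is_deriveB d2 (dQ' _ ts))).
  apply: (is_derive_eq d3); rewrite mulr1 (_ : eps * c *: _ = eps * c * (P (s + h) - P s))//; ring.
(* To first order in [h], the two-time form contributes ip D D - eps P and the correction eps c P;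
   as 1 - c = 2 / (p + 1), the sum is [energy s]. *)
have M0 s e : t / 2 < s -> 0 < e -> \forall h \near 0, `|M h s - energy s * h| <= e * `|h|.
  move=> ts e0; have s0 : 0 < s by rewrite (lt_trans _ ts)// divr_gt0.
  have dB : is_derive s 1 (fun r => ip (U r) (J (U s))) (eps * P s - ip (D s) (D s)).
    have := dU _ _ _ s0 (HJ _ _ (HU _ s0)); rewrite !JJ !ipNr => dB.
    by apply: (is_derive_eq dB); rewrite /P; ring.
  have e1 : 0 < e / (1 + `|eps * c|) by rewrite divr_gt0// ltr_pwDl.
  have /is_derive_littleoP/(_ _ e1) := dB.
  have /is_derive_littleoP/(_ _ e1) := dQ' _ ts.
  apply: filterS2 => h; rewrite ![h + s]addrC => h1 h2.
  have BJ a b : ip (U a) (J (U b)) = - ip (U b) (J (U a)) by rewrite -ipJ ipC.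
  have B0 : ip (U s) (J (U s)) = 0 by have := BJ s s; lra.
  rewrite B0 subr0 in h2.
  have -> : M h s - energy s * h = - (ip (U (s + h)) (J (U s)) - (eps * P s - ip (D s) (D s)) * h)
     + (eps * c) * (Q (s + h) - Q s - P s * h).
    by rewrite /M BJ /energy -/(P s) /c; field.
  rewrite (le_trans (ler_normD _ _))// normrN normrM.
  have -> : e * `|h| = e / (1 + `|eps * c|) * `|h| + `|eps * c| * (e / (1 + `|eps * c|) * `|h|).
    by field; rewrite gt_eqF// ltr_pwDl.
  by rewrite lerD// ler_wpM2l.
apply/is_derive_littleoP => e e0.
(* The squared increment will be at most (e / K) |h|, so that |eps| |L| e / K <= e; the added 1
   keeps [K] positive. *)
pose K := `|eps| * `|L| + 1.
have K0 : 0 < K by rewrite ltr_wpDl// mulr_ge0.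
have [[P1 Q1]/= [tP1 tQ1] inc] := ip_increment _ _ t0 (divr_gt0 e0 K0).
have [[P2 Q2]/= [tP2 tQ2] lip] := LN.
have : nbhs t ((P1 `&` Q1) `&` (P2 `&` Q2) `&` [set s | t / 2 < s]).
  apply: filterI; first by apply: filterI; exact: filterI.
  by apply: lt_nbhsr; rewrite ltr_pdivrMr// ltr_pMr// ltr1n.
move=> /nbhs_ballP[d /= d0 dG].
near=> k.
have kd : `|k| < d / 2 by near: k; apply: (@nbhs0_lt _ R^o); rewrite divr_gt0.
(* [h] is chosen after [k]: the slack [e'] absorbs the o(h) errors of [M0] at the two fixed times
   [t] and [k + t], and |h| is then divided out. *)
rewrite mul0r subr0; apply/ler_addgt0Pr => e' e'0.
have tt : t / 2 < t by rewrite ltr_pdivrMr// ltr_pMr// ltr1n.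
have hball (x : R) : `|x| < d -> ball t d (x + t).
  by move=> xd; rewrite /ball/= distrC addrK.
have d2d : d / 2 < d by rewrite ltr_pdivrMr// ltr_pMr// ltr1n.
have [_ kt] := dG _ (hball _ (lt_trans kd d2d)).
have e'2 : 0 < e' / 2 by rewrite divr_gt0.
near (0 : R)^' => h.
have h0 : h != 0 by near: h; exact: nbhs_dnbhs_neq.
have hd : `|h| < d / 2 by near: h; apply: dnbhs0_lt; rewrite divr_gt0.
have hk : `|M h (k + t) - energy (k + t) * h| <= e' / 2 * `|h|.
  by near: h; apply: cvg_within; exact: M0.
have ht : `|M h t - energy t * h| <= e' / 2 * `|h|.
  by near: h; apply: cvg_within; exact: M0.
have inball (x : R) : Num.min t (k + t) <= x <= Num.max t (k + t) ->
    `|x - t| < d / 2 /\ `|x + h - t| < d.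
  move=> /minmax_dist; rewrite addrK => xk; have xd := le_lt_trans xk kd; split => //.
  rewrite addrAC (le_lt_trans (ler_normD _ _))//; move: xd hd; lra.
have bnd (x : R) : `|x - t| < d -> ((P1 `&` Q1) `&` (P2 `&` Q2) `&` [set s | t / 2 < s]) x.
  by move=> /hball; rewrite subrK; exact: dG.
have [x /inball[x1 x2]|x /inball[x1 x2]] := @MVT_minmax R (M h)
    (fun s => eps * (ip (N s) (U (s + h)) - ip (N (s + h)) (U s) + c * (P (s + h) - P s))) t (k + t).
  by apply: dM; [have [] := bnd _ (lt_trans x1 d2d)|have [] := bnd _ x2].
rewrite addrK => ME.
have [[[xP1 xQ1] [xP2 xQ2]] xt] := bnd _ (lt_trans x1 d2d).
have [[[yP1 yQ1] [yP2 yQ2]] yt] := bnd _ x2.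
have := inc (x + h, x) (conj yP1 xQ1); rewrite /= opprD addrA subrr add0r normrN => q1.
have q2 := lip (x, x + h) (conj xP2 yQ2); rewrite /= in q2.
have q3 := ip_N_asym _ _ _ (lt_trans t20 xt) (lt_trans t20 yt) q2.
have q4 : `|M h (k + t) - M h t| <= e * `|h| * `|k|.
  rewrite ME normrM ler_wpM2r// normrM (le_trans (ler_wpM2l _ q3))//.
  rewrite (@le_trans _ _ (`|eps| * (`|L| * (e / K * `|h|))))//.
    by rewrite ler_wpM2l// (le_trans (ler_wpM2r _ (ler_norm _)))// ler_wpM2l.
  have -> : `|eps| * (`|L| * (e / K * `|h|)) = `|eps| * `|L| / K * (e * `|h|).
    by field; rewrite gt_eqF.
  by rewrite ler_piMl ?mulr_ge0 ?(ltW e0)// ler_pdivrMr// mul1r lerDl.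
rewrite -(ler_pM2r (_ : 0 < `|h|)) ?normr_gt0//.
rewrite -normrM mulrBl.
have -> : energy (k + t) * h - energy t * h = (M h (k + t) - M h t)
  - (M h (k + t) - energy (k + t) * h) + (M h t - energy t * h) by ring.
rewrite (le_trans (ler_normD _ _))//.
have -> : (e * `|k| + e') * `|h| = e * `|h| * `|k| + e' / 2 * `|h| + e' / 2 * `|h| by field.
by rewrite lerD// (le_trans (ler_normB _ _))// lerD.
Unshelve. all: by end_near. Qed.

Lemma energy_constant s t : 0 < s -> 0 < t -> energy s = energy t.
Proof. by move=> s0 t0; exact: eq_of_is_derive0 s0 t0 is_derive_energy. Qed.

End semi_inner_product.

(** * Smooth functions *)

Section smooth_functions.
Context {R : realType}.
Implicit Types (f g : R -> R) (x : R).

Definition smooth f := forall n x, derivable (derive1n n f) x 1.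

(** A coinduction principle: by induction on n every iterated derivative stays in the class [P], so
    no formula for n-th derivatives is ever written. *)
Lemma smooth_coind (P : (R -> R) -> Prop) f :
  (forall g, P g -> exists2 g', P g' & forall x, is_derive x 1 g (g' x)) ->
  P f -> smooth f.
Proof.
move=> Pd Pf n; have : P (derive1n n f).
  elim: n => [//|n /Pd[g' Pg' dg]]; rewrite (_ : derive1n n.+1 f = g')//.
  by apply/funext => x; rewrite derive1nS derive1E; apply: derive_val.
by move=> /Pd[g' _ dg] x.
Qed.

Lemma smooth_is_derive f : smooth f -> forall x, is_derive x 1 f ((derive1 f) x).
Proof. by move=> sf x; apply: DeriveDef; [exact: (sf 0%N)|rewrite derive1E]. Qed.

Lemma smooth_derive1 f : smooth f -> smooth (derive1 f).
Proof. by move=> sf n x; rewrite /derive1n -iterSr; exact: (sf n.+1). Qed.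

Lemma smooth_derivative f f' : (forall x, is_derive x 1 f (f' x)) -> smooth f' -> smooth f.
Proof.
move=> df sf' [x|n]; first by case: (df x).
rewrite /derive1n iterSr (_ : (derive1 f) = f'); first exact: sf'.
by apply/funext => x; rewrite derive1E; apply: derive_val.
Qed.

Lemma smooth_continuous f : smooth f -> continuous f.
Proof.
by move=> sf x; apply/differentiable_continuous/derivable1_diffP; exact: (sf 0%N).
Qed.

Lemma smoothD f g : smooth f -> smooth g -> smooth (f \+ g).
Proof.
move=> sf sg; apply: (@smooth_coind (fun h => exists f g, [/\ smooth f, smooth g & h = f \+ g])).
  move=> _ [a [b [sa sb ->]]]; exists ((derive1 a) \+ (derive1 b)).
    by exists (derive1 a), (derive1 b); split; [exact: smooth_derive1..|].
  by move=> x; apply: is_deriveD; exact: smooth_is_derive.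
by exists f, g.
Qed.

Lemma smooth_affine f (c a b : R) : smooth f -> smooth (fun x => c * f (a * x + b)).
Proof.
move=> sf; apply: (@smooth_coind (fun h => exists c f, smooth f /\ h = fun x => c * f (a * x + b))).
  move=> _ [k [g [sg ->]]]; exists (fun x => k * a * (derive1 g) (a * x + b)).
    by exists (k * a), (derive1 g); split; [exact: smooth_derive1|].
  move=> x; have d1 := is_derive_affine a b x.
  have dg := smooth_is_derive _ sg (a * x + b).
  have d2 := is_deriveZ k (@is_derive1_comp _ g (fun x => a * x + b) x _ _ dg d1).
  by apply: (is_derive_eq d2); rewrite -mulrA; exact: (congr1 ( *%R k) (mulrC _ _)).
by exists c, f.
Qed.

(** Products alone are not closed under differentiation; finite sums of products are, by the Leibniz
    rule. *)
Inductive product_class : (R -> R) -> Prop :=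
| product_class_mul f g : smooth f -> smooth g -> product_class (f \* g)
| product_class_add f g : product_class f -> product_class g -> product_class (f \+ g).

Lemma smoothM f g : smooth f -> smooth g -> smooth (f \* g).
Proof.
move=> sf sg; apply: (smooth_coind product_class); last exact: product_class_mul.
move=> h; elim=> {h} [a b sa sb|a b _ [a' pa' da] _ [b' pb' db]].
  exists ((a \* (derive1 b)) \+ (b \* (derive1 a))).
    have [sa' sb'] := (smooth_derive1 _ sa, smooth_derive1 _ sb).
    by apply: product_class_add; [exact: product_class_mul sa sb'|exact: product_class_mul sb sa'].
  by move=> x; apply: is_deriveM; exact: smooth_is_derive.
exists (a' \+ b'); first exact: product_class_add.
by move=> x; apply: is_deriveD.
Qed.

(** Monomials are controlled by y^n / n! <= expR y, whence the factorials in the constant. Applied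
    at y = 1 / x, this gives flatness at 0. *)
Lemma poly_le_expR (p : {poly R}) : exists C : R, 0 < C /\
  forall y, 0 <= y -> `|p.[y]| <= C * expR y.
Proof.
exists (1 + \sum_(i < size p) `|p`_i| * i`!%:R); split.
  by rewrite ltr_pwDl// sumr_ge0// => i _; rewrite mulr_ge0.
move=> y y0; rewrite horner_coef mulrDl mul1r ler_wpDl ?expR_ge0//.
rewrite (le_trans (ler_norm_sum _ _ _))// mulr_suml ler_sum// => -[[|i] ip] _ /=.
  by rewrite expr0 mulr1 fact0 mulr1 ler_peMr// -expR0 ler_expR.
rewrite normrM -mulrA ler_wpM2l// ger0_norm ?exprn_ge0// mulrC -ler_pdivrMr ?ltr0n ?fact_gt0//.
by rewrite (le_trans _ (expR_ge1Dxn i y0))// lerDr.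
Qed.

(** The polynomial factor makes the family closed under differentiation, which sends p to X^2 (p -
    p'). *)
Definition flat_exp (p : {poly R}) x : R :=
  if 0 < x then p.[x^-1] * expR (- x^-1) else 0.

Lemma is_derive_flat_exp (p : {poly R}) x :
  is_derive x 1 (flat_exp p) (flat_exp ('X^2 * (p - p^`())) x).
Proof.
have [x0|x0|->] := ltgtP x 0.
- apply: (@near_eq_is_derive _ _ _ (cst 0)); last first.
    by rewrite /flat_exp ltNge ltW//=; exact: is_derive_cst.
  by near=> y; rewrite /flat_exp ltNge ltW//; near: y; exact: lt_nbhsl.
- apply: (@near_eq_is_derive _ _ _ (fun x => p.[x^-1] * expR (- x^-1))).
  + by near=> y; rewrite /flat_exp ifT//; near: y; exact: lt_nbhsr.
  have dinv : is_derive x 1 (fun x : R => x^-1) (- x ^- 2).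
    have dv := @is_deriveV _ id x 1 1 (lt0r_neq0 x0) (is_derive_id x (1 : R)).
    by apply: (is_derive_eq dv); rewrite [_ *: _]mulr1.
  have d1 := @is_derive1_comp _ (horner p) (fun x => x^-1) x _ _ (is_derive_poly p x^-1) dinv.
  have d2 := @is_derive1_comp _ expR (fun x => - x^-1) x _ _ (is_derive_expR (- x^-1)) (is_deriveN dinv).
  apply: (is_derive_eq (is_deriveM d1 d2)).
  rewrite /flat_exp x0 !hornerE /=.
  transitivity (p.[x^-1] * (expR (- x^-1) * - - x ^- 2) +
    expR (- x^-1) * (p^`().[x^-1] * - x ^- 2)); first by [].
  by rewrite exprVn; ring.
rewrite [X in is_derive _ _ _ X](_ : _ = 0); last by rewrite /flat_exp ltxx.
apply/is_derive_littleoP => e e0.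
(* Bounding X^2 p instead of p gains two powers: |flat_exp p k| <= C k^2, which is o(k). *)
have [C [C0 Cp]] := poly_le_expR ('X^2 * p).
near=> k; rewrite addr0 mul0r subr0 /flat_exp ltxx subr0.
case: ifPn => [k0|_]; last by rewrite normr0 mulr_ge0 ?(ltW e0).
have ki0 : 0 <= k^-1 by rewrite invr_ge0 ltW.
have := Cp _ ki0; rewrite hornerM hornerXn normrM normrX (ger0_norm ki0).
rewrite mulrC -ler_pdivlMr ?exprn_gt0 ?invr_gt0// => pk.
rewrite normrM [`|expR _|]ger0_norm ?expR_ge0// (le_trans (ler_wpM2r _ pk)) ?expR_ge0//.
have -> : C * expR k^-1 / k^-1 ^+ 2 * expR (- k^-1) = C * k * k.
  rewrite expRN exprVn invrK; field.
  by rewrite gt_eqF ?expR_gt0.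
rewrite gtr0_norm// ler_wpM2r ?(ltW k0)// -ler_pdivlMl// mulrC.
rewrite (le_trans (ler_norm _))//; near: k; apply: (@nbhs0_le _ R^o).
by rewrite divr_gt0.
Unshelve. all: by end_near. Qed.

Lemma smooth_flat_exp (p : {poly R}) : smooth (flat_exp p).
Proof.
apply: (@smooth_coind (fun h => exists p, h = flat_exp p)); last by exists p.
move=> _ [q ->]; exists (flat_exp ('X^2 * (q - q^`()))); first by eexists.
by move=> x; exact: is_derive_flat_exp.
Qed.

Definition bump x := flat_exp 1 (1 * x + 1) * flat_exp 1 (-1 * x + 1).

Lemma flat_exp1_itv x : 0 <= flat_exp 1 x <= 1.
Proof.
rewrite /flat_exp; case: ifPn => [x0|_]; last by rewrite lexx ler01.
by rewrite hornerC mul1r expR_ge0 -[leRHS]expR0 ler_expR oppr_le0 invr_ge0 ltW.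
Qed.

Lemma flat_exp1_gt0 x : 0 < x -> 0 < flat_exp 1 x.
Proof. by rewrite /flat_exp => ->; rewrite hornerC mul1r expR_gt0. Qed.

Lemma smooth_bump : smooth bump.
Proof.
have s a : smooth (fun x => flat_exp 1 (a * x + 1)).
  have := smooth_affine _ 1 a 1 (smooth_flat_exp 1).
  by under eq_fun do rewrite mul1r.
exact: smoothM (s 1) (s (-1)).
Qed.

Lemma bump_itv x : 0 <= bump x <= 1.
Proof.
have /andP[a0 a1] := flat_exp1_itv (1 * x + 1).
have /andP[b0 b1] := flat_exp1_itv (-1 * x + 1).
by rewrite /bump mulr_ge0//= mulr_ile1.
Qed.

Lemma bump_eq0 x : 1 <= `|x| -> bump x = 0.
Proof.
rewrite ler_normr /bump /flat_exp => /orP[|] x1.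
  by rewrite [X in _ * X]ifF ?mulr0//; apply/negbTE; rewrite -leNgt; lra.
by rewrite ifF ?mul0r//; apply/negbTE; rewrite -leNgt; lra.
Qed.

(** [S] is a normalized primitive of [bump]. It serves twice: rescaled copies of [S] form the
    spatial cutoff, and rescaled copies of [S'] are the mollifiers, so that a smoothed indicator has
    a difference of mollifiers as derivative. *)
Lemma smooth_step : exists S S' : R -> R, exists C : R,
  [/\ smooth S, forall x, is_derive x 1 S (S' x), forall x, x <= -1 -> S x = 0,
      forall x, 1 <= x -> S x = 1 &
      [/\ forall x, 0 <= S x <= 1, forall x, 0 <= S' x <= C & forall x, 1 <= `|x| -> S' x = 0]].
Proof.
(* The primitive starts at -2, to the left of the support of [bump]. Nothing is known of it below
   -2, so [G] replaces it left of -1 by the constant [F (-1)], its value on ]-2, -1]. *)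
have [F dF] := continuous_antiderivative _ (-2) (smooth_continuous _ smooth_bump).
pose G x := if x < -1 then F (-1) else F x.
have FG x : -2 < x -> G x = F x.
  rewrite /G; case: ifPn => // x1 x2.
  have [y /andP[]|y /andP[]] := @MVT_minmax _ F bump x (-1).
    by rewrite min_l ?(ltW x1)// => xy _; apply: dF; exact: lt_le_trans xy.
  rewrite max_r ?(ltW x1)// => _ y1; rewrite bump_eq0 ?mul0r; first by move/subr0_eq.
  by rewrite ler_normr; apply/orP; right; lra.
have dG x : is_derive x 1 G (bump x).
  have [x2|x2] := ltP (-2) x.
    apply: (@near_eq_is_derive _ _ _ F); last exact: dF.
    by near=> y; rewrite FG//; near: y; exact: lt_nbhsr.
  apply: (@near_eq_is_derive _ _ _ (cst (F (-1)))).
    near=> y; rewrite /G ifT//; near: y; apply: lt_nbhsl; lra.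
  rewrite bump_eq0; first exact: is_derive_cst.
  by rewrite ler_normr; apply/orP; right; lra.
have Ghomo x y : x <= y -> G x <= G y.
  move=> xy; have [z _] := @MVT_minmax _ G bump x y (fun z _ => dG z).
  rewrite -subr_ge0 => ->; rewrite mulr_ge0 ?subr_ge0//.
  by have /andP[] := bump_itv z.
have Gm x : x <= -1 -> G x = G (-1).
  by rewrite /G ltxx le_eqVlt => /predU1P[->|->//]; rewrite ltxx.
have Gp x : 1 <= x -> G x = G 1.
  move=> x1; have [z /andP[]] := @MVT_minmax _ G bump 1 x (fun z _ => dG z).
  rewrite min_l// => z1 _; rewrite bump_eq0 ?mul0r; first by move/subr0_eq.
  by rewrite ler_normr z1.
have G1 : G (-1) < G 1.
  have [||z] := @MVT _ G bump (-1) 1 _ (fun z _ => dG z); first lra.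
    by apply: derivable_within_continuous => z _; case: (dG z).
  rewrite in_itv/= => /andP[z1 z2]; rewrite -subr_gt0 => ->.
  apply: mulr_gt0; last by lra.
  by apply: mulr_gt0; apply: flat_exp1_gt0; lra.
pose m := (G 1 - G (-1))^-1.
have m0 : 0 < m by rewrite invr_gt0 subr_gt0.
pose S x := m * (G x - G (-1)); pose S' x := m * bump x.
have dS x : is_derive x 1 S (S' x).
  have d1 := is_deriveZ m (is_deriveB (dG x) (is_derive_cst (G (-1)) x (1 : R))).
  by apply: (is_derive_eq d1); rewrite subr0.
exists S, S', m; split => //.
- apply: (smooth_derivative _ S') => //.
  have := smooth_affine _ m 1 0 smooth_bump.
  by under eq_fun do rewrite mul1r addr0.
- by move=> x /Gm xm; rewrite /S xm subrr mulr0.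
- by move=> x /Gp xp; rewrite /S xp mulVf// subr_eq0 gt_eqF.
split=> x.
- have xm : G (-1) <= G x by have [/Ghomo//|/ltW/Gm->] := leP (-1) x.
  have xp : G x <= G 1 by have [/Ghomo//|/ltW/Gp->] := leP x 1.
  by rewrite /S mulr_ge0 ?subr_ge0 ?(ltW m0)//= ler_pdivrMl ?subr_gt0// mulr1 lerD2r.
- have /andP[b0 b1] := bump_itv x.
  by rewrite /S' mulr_ge0 ?(ltW m0)//= ger_pMr.
- by move=> x1; rewrite /S' bump_eq0 ?mulr0.
Unshelve. all: by end_near. Qed.

End smooth_functions.

(** * Square integrable functions *)

#[global] Instance ae_lebesgue_filter (R : realType) :
  Filter (nbhs (almost_everywhere (@lebesgue_measure R))) :=
  @ae_filter_ringOfSetsType _ _ _ (@lebesgue_measure R).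

Section square_integrable.
Context {R : realType}.
Implicit Types (f g : R -> R).
Local Notation lam := (@lebesgue_measure R).

Lemma one_le2E : (1 <= 2%:E :> \bar R)%E.
Proof. by rewrite lee_fin ler1n. Qed.

Lemma ae_eq_Rintegral f g : lam.-integrable setT (EFin \o f) ->
  measurable_fun setT g ->
  {ae lam, forall x, f x = g x} -> \int[lam]_x f x = \int[lam]_x g x.
Proof.
move=> /integrableP[/measurable_EFinP mf _] mg fg; rewrite /Rintegral.
congr fine; apply: ae_eq_integral => //; [exact/measurable_EFinP|exact/measurable_EFinP|].
by move: fg; apply: filterS => x /= -> _.
Qed.

Lemma integrable_measurable f : lam.-integrable setT (EFin \o f) -> measurable_fun setT f.
Proof. by move=> /integrableP[/measurable_EFinP]. Qed.

Lemma integrableB_EFin f g : lam.-integrable setT (EFin \o f) ->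
  lam.-integrable setT (EFin \o g) -> lam.-integrable setT (EFin \o (fun x => f x - g x)).
Proof. by move=> intf intg; apply: (integrableB _ intf intg). Qed.

Lemma integrableD_EFin f g : lam.-integrable setT (EFin \o f) ->
  lam.-integrable setT (EFin \o g) -> lam.-integrable setT (EFin \o (fun x => f x + g x)).
Proof. by move=> intf intg; apply: (integrableD _ intf intg). Qed.

Lemma integrableZ_EFin (k : R) f : lam.-integrable setT (EFin \o f) ->
  lam.-integrable setT (EFin \o (fun x => k * f x)).
Proof. by move=> intf; apply: (integrableZl _ k intf). Qed.

Lemma ae_le_Rintegral f g : lam.-integrable setT (EFin \o f) ->
  lam.-integrable setT (EFin \o g) ->
  {ae lam, forall x, f x <= g x} -> \int[lam]_x f x <= \int[lam]_x g x.
Proof.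
move=> intf intg fg; rewrite -subr_ge0 -RintegralB//.
(* The difference is replaced by its absolute value, equal to it almost everywhere and nonnegative
   at every point. *)
rewrite (ae_eq_Rintegral _ (fun x => `|g x - f x|)).
- by apply: Rintegral_ge0 => x _.
- exact: integrableB_EFin.
- apply: measurableT_comp => //; apply: measurable_funB; exact: integrable_measurable.
by move: fg; apply: filterS => x fgx; rewrite ger0_norm ?subr_ge0.
Qed.

Lemma integrable_dominated f g : measurable_fun setT f ->
  lam.-integrable setT (EFin \o g) -> {ae lam, forall x, `|f x| <= g x} ->
  lam.-integrable setT (EFin \o f).
Proof.
move=> mf /integrableP[mg ig] fg; apply/integrableP; split.
  exact/measurable_EFinP.
apply: le_lt_trans ig; apply: ae_ge0_le_integral => //.
- by apply: measurableT_comp => //; exact/measurable_EFinP.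
- exact: measurableT_comp.
move: fg; apply: filterS => x fgx _ /=; rewrite lee_fin (le_trans fgx)//; exact: ler_norm.
Qed.

Lemma Lfun2P f : f \in Lfun lam 2%:E <->
  measurable_fun setT f /\ lam.-integrable setT (EFin \o (fun x => f x ^+ 2)).
Proof.
split=> [f2|[mf if2]].
  split; last exact: Lfun2_integrable_sqr.
  by move: f2; rewrite inE => /andP[+ _]; rewrite inE.
rewrite inE; apply/andP; split; first by rewrite inE.
rewrite inE/= /finite_norm unlock /=; apply: poweR_lty.
move/integrableP : if2 => [_]; apply: le_lt_trans.
under [leRHS]eq_integral do rewrite /= ger0_norm ?sqr_ge0//.
apply: ge0_le_integral => //.
- by apply/measurable_EFinP; apply: (measurableT_comp (measurable_powR _)) => //; exact: measurableT_comp.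
- by apply/measurable_EFinP; exact: measurable_funX.
by move=> x _; rewrite lee_fin powR_mulrn// real_normK// num_real.
Qed.

Lemma Lfun2_dominated f g (C : R) : measurable_fun setT f -> g \in Lfun lam 2%:E ->
  {ae lam, forall x, `|f x| <= C * `|g x|} -> f \in Lfun lam 2%:E.
Proof.
move=> mf /Lfun2P[mg ig] fg; apply/Lfun2P; split => //.
apply: (@integrable_dominated _ (fun x => C ^+ 2 * g x ^+ 2)).
- exact: measurable_funX.
- exact: integrableZ_EFin.
move: fg; apply: filterS => x fgx; rewrite ger0_norm ?sqr_ge0//.
rewrite -(real_normK (num_real (f x))) -[g x ^+ 2](real_normK (num_real (g x))).
by rewrite -exprMn lerXn2r// nnegrE (le_trans _ fgx).
Qed.

Lemma Lfun2M f g : f \in Lfun lam 2%:E -> g \in Lfun lam 2%:E ->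
  lam.-integrable setT (EFin \o (fun x => f x * g x)).
Proof. by move=> f2 g2; apply/Lfun1_integrable; exact: Lfun2_mul_Lfun1. Qed.

Lemma integrable_segment f (a b : R) : f \in Lfun lam 2%:E ->
  lam.-integrable `[a, b] (EFin \o f).
Proof.
move=> /Lfun2P[mf if2]; rewrite integrable_mkcond//.
rewrite (_ : _ \_ _ = EFin \o (f \_ `[a, b]%classic)); last by rewrite restrict_EFin.
(* On the segment |f| <= f^2 + 1, and the constant is integrable there. *)
apply: (@integrable_dominated _ (fun x => (f x ^+ 2 + \1_(`[a, b]%classic) x))).
- by apply/(measurable_restrictT _ _).1 => //; exact: measurable_funS mf.
- apply: integrableD_EFin => //; exact: integrable_indic_itv.
apply: aeW => x /=; rewrite patchE indicE; case: ifP => _ /=; last first.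
  by rewrite normr0 addr0 sqr_ge0.
by rewrite -[f x ^+ 2](real_normK (num_real (f x))); have := sqr_ge0 (`|f x| - 1); nra.
Qed.

Lemma Lfun2_bounded_support f (a b M : R) : measurable_fun setT f ->
  (forall x, `|f x| <= M) -> (forall x, x \notin `[a, b] -> f x = 0) ->
  f \in Lfun lam 2%:E.
Proof.
move=> mf fM f0; apply: (@Lfun2_dominated _ \1_(`[a, b]%classic) M) => //.
  apply/Lfun2P; split; first exact: measurable_indic.
  rewrite (_ : (fun x => _) = \1_(`[a, b]%classic)); first exact: integrable_indic_itv.
  by apply/funext => x; rewrite indicE; case: (_ \in _); rewrite /= ?expr0n ?expr1n.
apply: aeW => x; rewrite indicE mem_setE; have [_|/f0 ->] := boolP (x \in `[a, b]); last first.
  by rewrite !normr0 mulr0.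
by rewrite normr1 mulr1.
Qed.

End square_integrable.

(** * Test functions and their square integrability *)

Section test_functions.
Context {R : realType}.
Implicit Types (f g phi : R -> R).
Local Notation lam := (@lebesgue_measure R).

Lemma smooth_support_test phi (a b : R) : smooth phi ->
  (forall x, x \notin `[a, b] -> phi x = 0) -> test_function phi.
Proof.
move=> sphi phi0; split => //.
apply: (@subclosed_compact _ _ `[a, b]%classic); first exact: closed_closure.
  exact: segment_compact.
rewrite [X in _ `<=` X](closure_id _).1; last exact: interval_closed.
apply: closureS => x /= phix; apply: contraNT phix => xab.
by rewrite phi0.
Qed.

Lemma test_smooth phi : test_function phi -> smooth phi.
Proof. by case. Qed.

Lemma test_support phi : test_function phi ->
  exists A : R, forall x, x \notin `[- A, A] -> phi x = 0.
Proof.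
move=> [_ /compact_bounded[M [_ Mb]]]; exists (M + 1) => x xM.
apply: contrapT => phix0; move/negP : xM; apply.
have := Mb (M + 1) (ltr_pwDr ltr01 (lexx _)) x.
rewrite in_itv/= -ler_norml; apply; apply: subset_closure; exact/eqP.
Qed.

Lemma test_Lfun2 phi : test_function phi -> phi \in Lfun lam 2%:E.
Proof.
move=> tphi; have [A A0] := test_support _ tphi.
have cphi := smooth_continuous _ (test_smooth _ tphi).
have [M phiM] : exists M, forall x, `|phi x| <= M.
  (* For negative [A] the segment is empty and [phi] vanishes identically. *)
  have [A0'|A0'] := leP 0 A; last first.
    exists 0 => x; rewrite A0 ?normr0// in_itv/=; apply/negP => /andP[] /le_trans/[apply].
    by lra.
  have [||c _ cM] := @EVT_max R (fun x => `|phi x|) (- A) A _.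
  - by lra.
  - move=> x; apply: continuous_subspaceT => {}x; apply: cvg_norm; exact: cphi.
  exists `|phi c| => x; have [/cM//|/A0 ->] := boolP (x \in `[- A, A]).
  by rewrite normr0.
apply: (Lfun2_bounded_support _ (- A) A M) => //.
exact: continuous_measurable_fun.
Qed.

Lemma derive1_test phi : test_function phi -> test_function (derive1 phi).
Proof.
move=> tphi; have [A A0] := test_support _ tphi.
apply: (@smooth_support_test _ (- A) A).
  exact/smooth_derive1/test_smooth.
move=> x xA; rewrite derive1E.
suff : is_derive x 1 phi 0 by move=> dphi; apply: derive_val.
apply: (@near_eq_is_derive _ _ _ (@cst R R 0)).
have : nbhs x (~` `[- A, A]%classic).
  apply: open_nbhs_nbhs; split; last exact/negP.
  by apply: closed_openC; exact: interval_closed.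
by apply: filterS => y /= /negP /A0.
Qed.

End test_functions.

(** * Weak derivatives *)

Lemma near_lt_of_cvge0 {R : realType} {T : Type} {F : set_system T} {FF : Filter F}
    (f : T -> \bar R) (e : R) : f x @[x --> F] --> 0%E -> 0 < e ->
  \forall x \near F, (f x < e%:E)%E.
Proof.
move=> /fine_cvgP[ffin /cvgrPdist_lt f0] e0; have := f0 _ e0.
apply: filterS2 ffin => x fx; rewrite sub0r normrN => fxe.
by rewrite -(fineK fx) lte_fin (le_lt_trans (ler_norm _)).
Qed.

Section mollifier.
Context {R : realType}.
Implicit Types (f g phi : R -> R) (k a x : R).
Local Notation lam := (@lebesgue_measure R).

Context {S S' : R -> R} {C : R}.
Hypotheses (smoothS : smooth S) (dS : forall x, is_derive x 1 S (S' x))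
  (S0 : forall x, x <= -1 -> S x = 0) (S1 : forall x, 1 <= x -> S x = 1)
  (S01 : forall x, 0 <= S x <= 1) (S'C : forall x, 0 <= S' x <= C)
  (S'0 : forall x, 1 <= `|x| -> S' x = 0).

(** For large [k], a smoothed Heaviside step at [a]; its derivative [mollifier] approximates a unit
    mass at [a] and is carried by an interval of half-width 1 / k. *)
Definition step_at k a x := S (k * x + - (k * a)).
Definition mollifier k a x := k * S' (k * x + - (k * a)).

Lemma smooth_step_derivative : smooth S'.
Proof.
rewrite (_ : S' = derive1 S); first exact: smooth_derive1.
by apply/funext => x; rewrite derive1E; apply/esym; apply: derive_val.
Qed.

Lemma smooth_mollifier k a : smooth (mollifier k a).
Proof. exact: smooth_affine smooth_step_derivative. Qed.

Lemma smooth_step_at k a : smooth (step_at k a).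
Proof.
by have := smooth_affine _ 1 k (- (k * a)) smoothS; under eq_fun do rewrite mul1r.
Qed.

Lemma is_derive_step_at k a x : is_derive x 1 (step_at k a) (mollifier k a x).
Proof.
have d1 := is_derive_affine k (- (k * a)) x.
rewrite /mollifier [k * S' _]mulrC.
exact: (@is_derive1_comp _ S (fun x => k * x + - (k * a)) x _ _ (dS _) d1).
Qed.

Lemma mollifier_eq0 k a x : 0 < k -> x \notin `[a - k^-1, a + k^-1] -> mollifier k a x = 0.
Proof.
move=> k0 xa; rewrite /mollifier S'0 ?mulr0//.
rewrite -mulrBr normrM gtr0_norm// -ler_pdivrMl// mulr1.
by apply: ltW; move: xa; rewrite in_itv/= -ler_distlC -ltNge distrC.
Qed.

Lemma step_at_eq0 k a x : 0 < k -> x <= a - k^-1 -> step_at k a x = 0.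
Proof.
move=> k0 xa; apply: S0; have := ler_wpM2l (ltW k0) xa.
by rewrite mulrBr mulfV ?gt_eqF//; lra.
Qed.

Lemma step_at_eq1 k a x : 0 < k -> a + k^-1 <= x -> step_at k a x = 1.
Proof.
move=> k0 xa; apply: S1; have := ler_wpM2l (ltW k0) xa.
by rewrite mulrDr mulfV ?gt_eqF//; lra.
Qed.

Lemma mollifier_test k a : 0 < k -> test_function (mollifier k a).
Proof.
move=> k0; apply: smooth_support_test (smooth_mollifier k a) _ => x.
exact: mollifier_eq0.
Qed.

Lemma integrable_mollifier k a : 0 < k -> lam.-integrable setT (EFin \o mollifier k a).
Proof.
move=> k0; have := integrable_segment _ (a - k^-1) (a + k^-1) (test_Lfun2 _ (mollifier_test _ a k0)).
rewrite integrable_mkcond//; apply: eq_integrable => // x _.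
rewrite patchE; case: ifPn => //; rewrite mem_setE => /(mollifier_eq0 _ _ _ k0) /= ->.
by [].
Qed.

Lemma Rintegral_mollifier k a : 0 < k -> \int[lam]_x mollifier k a x = 1.
Proof.
move=> k0; have ki0 : 0 < k^-1 by rewrite invr_gt0.
have aa : a - k^-1 < a + k^-1 by rewrite ltrD2l; lra.
rewrite [LHS](_ : _ = \int[lam]_(x in `[a - k^-1, a + k^-1]) mollifier k a x); last first.
  rewrite [RHS]Rintegral_mkcond; apply: eq_Rintegral => x _.
  by rewrite patchE mem_setE; case: ifPn => // /(mollifier_eq0 _ _ _ k0).
rewrite /Rintegral (@continuous_FTC2 _ _ (step_at k a))//.
- by rewrite /= step_at_eq1// step_at_eq0// subr0.
- apply: continuous_subspaceT => x; exact: smooth_continuous (smooth_mollifier k a) x.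
- have cS := smooth_continuous _ (smooth_step_at k a).
  split.
  + by move=> x _; case: (is_derive_step_at k a x).
  + exact/cvg_at_right_filter/cS.
  + exact/cvg_at_left_filter/cS.
- by move=> x _; rewrite derive1E; have dx := is_derive_step_at k a x; exact: derive_val.
Qed.

Lemma Lfun2_locally_integrable f : f \in Lfun lam 2%:E -> locally_integrable setT f.
Proof.
move=> f2; split; [by have [] := (Lfun2P f).1 f2|exact: openT|move=> K _ cK].
have [M [_ Mb]] := compact_bounded cK.
have /integrableP[_] := integrable_segment _ (- (M + 1)) (M + 1) f2.
apply: le_lt_trans; apply: ge0_subset_integral => //.
- exact: compact_measurable.
- apply/measurable_funTS/measurable_EFinP; apply: measurableT_comp => //.
  by have [] := (Lfun2P f).1 f2.
- move=> x Kx; rewrite /= in_itv/= -ler_norml.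
  exact: (Mb (M + 1) (ltr_pwDr ltr01 (lexx _)) x Kx).
Qed.

Lemma step_derivative_bound_ge0 : 0 <= C.
Proof. by have /andP[/le_trans] := S'C 0; apply. Qed.

(** The mollifier is at most C k = 4 C / (4 / k), and 4 / k is the length of the ball of radius 2 /
    k. This radius exceeds 1 / k so that the open ball contains the closed interval carrying the
    mollifier. *)
Lemma mollifier_davg f k a : 0 < k -> f \in Lfun lam 2%:E ->
  (`|\int[lam]_x (f x * mollifier k a x) - f a|%:E <= (4 * C)%:E * davg f a (2 / k))%E.
Proof.
move=> k0 f2; have [mf _] := (Lfun2P f).1 f2.
have im := integrable_mollifier k a k0.
have ifm : lam.-integrable setT (EFin \o (fun x => f x * mollifier k a x)).
  exact: Lfun2M f2 (test_Lfun2 _ (mollifier_test _ a k0)).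
have ifam := integrableZ_EFin (f a) _ im.
have -> : \int[lam]_x (f x * mollifier k a x) - f a =
    \int[lam]_x (f x * mollifier k a x - f a * mollifier k a x).
  by rewrite RintegralB// RintegralZl// Rintegral_mollifier// mulr1.
have ig := integrableB_EFin _ _ ifm ifam.
rewrite EFin_normr_Rintegral//.
have mg := integrable_measurable _ ig.
apply: le_trans.
  by apply: le_abse_integral => //; exact/measurable_EFinP.
have k20 : 0 < 2 / k by rewrite divr_gt0.
rewrite /davg /iavg lebesgue_measure_ball ?(ltW k20)// muleA inver mulrn_eq0/= gt_eqF//= -EFinM.
have -> : 4 * C * (2 / k *+ 2)^-1 = C * k by rewrite -mulr_natr; field; rewrite gt_eqF.
have mfa : measurable_fun (ball a (2 / k)) (fun y => `|((center (f a) \o f) y)%:E|%E).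
  apply/measurable_funTS; apply: measurableT_comp => //; apply/measurable_EFinP.
  exact: measurable_funD.
rewrite -ge0_integralZl//; last 2 first.
- exact: measurable_ball.
- by rewrite lee_fin mulr_ge0 ?step_derivative_bound_ge0 ?(ltW k0).
rewrite [leRHS]integral_mkcond; apply: ge0_le_integral => //.
- by apply/measurable_EFinP; exact: measurableT_comp.
- apply: (measurable_restrictT _ _).1; first exact: measurable_ball.
  by apply: measurable_funeM; exact: mfa.
move=> x _ /=; rewrite patchE; case: ifPn => [_|].
  rewrite -EFinM lee_fin -mulrBl normrM mulrC ler_wpM2r//.
  rewrite /mollifier normrM gtr0_norm// mulrC ler_wpM2r ?(ltW k0)//.
  by have /andP[s1 s2] := S'C (k * x + - (k * a)); rewrite ger0_norm.
rewrite notin_setE /ball /= => /negP; rewrite -leNgt => xa.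
rewrite -mulrBl mollifier_eq0 ?mulr0 ?normr0//.
rewrite in_itv/= -ler_distlC -ltNge (lt_le_trans _ xa)// ltr_pdivlMr// mulVf ?gt_eqF//.
by rewrite ltr1n.
Qed.

Lemma mollifier_cvg f a e : f \in Lfun lam 2%:E -> lebesgue_pt f a -> 0 < e ->
  exists2 K, 0 < K & forall k, K <= k ->
    `|\int[lam]_x (f x * mollifier k a x) - f a| <= e.
Proof.
move=> f2 fa e0.
have C1 : 0 < 4 * C + 1 by rewrite ltr_wpDl// mulr_ge0// step_derivative_bound_ge0.
have e1 : 0 < e / (4 * C + 1) by rewrite divr_gt0.
have : \forall r \near (0 : R)^'+, (davg f a r < (e / (4 * C + 1))%:E)%E.
  exact: near_lt_of_cvge0.
(* Then 2 / k <= d / 2, strictly below [d]. *)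
move=> [d /= d0 dr]; exists (4 / d); first by rewrite divr_gt0.
move=> k dk; have k0 : 0 < k by rewrite (lt_le_trans _ dk)// divr_gt0.
rewrite -lee_fin (le_trans (mollifier_davg _ _ _ k0 f2))//.
have k20 : 0 < 2 / k by rewrite divr_gt0.
have /= := dr (2 / k); rewrite sub0r normrN gtr0_norm//.
have dk2 : 2 / k < d.
  rewrite ltr_pdivrMr// mulrC -ltr_pdivrMr//; apply: lt_le_trans dk.
  by rewrite ltr_pM2r ?invr_gt0// ltr_nat.
move=> /(_ dk2 k20)/ltW h.
rewrite (le_trans (lee_wpmul2l _ h))// ?lee_fin ?mulr_ge0 ?step_derivative_bound_ge0//.
rewrite mulrCA ler_piMr ?(ltW e0)// ler_pdivrMr// mul1r lerDl//.
Qed.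

(** At a Lebesgue point the integrals against mollifiers converge to the value of [f], and all of
    them vanish. *)
Lemma du_bois_reymond_step f : f \in Lfun lam 2%:E ->
  (forall phi, test_function phi -> \int[lam]_x (f x * phi x) = 0) ->
  {ae lam, forall x, f x = 0}.
Proof.
move=> f2 f0; move: (lebesgue_differentiation (Lfun2_locally_integrable _ f2)).
apply: filterS => a fa; apply/eqP; rewrite -normr_le0; apply/ler_addgt0Pr => e e0.
have [K K0 fK] := mollifier_cvg _ _ _ f2 fa e0; have := fK K (lexx _).
by rewrite (f0 _ (mollifier_test _ _ K0)) sub0r normrN add0r.
Qed.

Definition weak_derivative f g := forall phi, test_function phi ->
  \int[lam]_x (f x * derive1 phi x) = - \int[lam]_x (g x * phi x).

Lemma Rintegral_indic_itv (a b c : R) : a <= b ->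
  \int[lam]_x (c * \1_(`[a, b]%classic) x) = c * (b - a).
Proof.
move=> ab; rewrite RintegralZl//; last exact: integrable_indic_itv.
rewrite /Rintegral integral_indic// setIT.
transitivity (c * fine (b - a)%:E) => //; congr (c * fine _).
rewrite [LHS](@lebesgue_measure_itv R `[a, b]) /= lte_fin.
have [//|ba|->] := ltgtP a b; last by rewrite subrr.
by move: ab; rewrite leNgt ba.
Qed.

Lemma sqr_le_of_norm (x y : R) : `|x| <= y -> x ^+ 2 <= y ^+ 2.
Proof.
move=> xy; rewrite -(real_normK (num_real x)) lerXn2r// nnegrE.
exact: le_trans xy.
Qed.

Lemma cauchy_schwarz_Lfun2 f g : f \in Lfun lam 2%:E -> g \in Lfun lam 2%:E ->
  (\int[lam]_x (f x * g x)) ^+ 2 <= \int[lam]_x (f x ^+ 2) * \int[lam]_x (g x ^+ 2).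
Proof.
move=> f2 g2; pose rip (v w : LfunType lam one_le2E) := \int[lam]_x (v x * w x).
have L (v : LfunType lam one_le2E) : (v : R -> R) \in Lfun lam 2%:E by exact: LfunP.
have ripC v w : rip v w = rip w v.
  by apply: eq_Rintegral => x _; rewrite mulrC.
have ripDl v w z : rip (v + w) z = rip v z + rip w z.
  rewrite /rip -RintegralD//; try exact: Lfun2M.
  by apply: eq_Rintegral => y _; rewrite /= mulrDl.
have ripZl (r : R) v w : rip (r *: v) w = r * rip v w.
  rewrite /rip -RintegralZl//; last exact: Lfun2M.
  by apply: eq_Rintegral => y _; rewrite /= -mulrA.
have rip_ge0 v : 0 <= rip v v.
  by apply: Rintegral_ge0 => x _; rewrite -expr2 sqr_ge0.
have := @cauchy_schwarz R _ rip ripC ripDl ripZl rip_ge0 (Lfun_Sub one_le2E f2) (Lfun_Sub one_le2E g2).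
move=> /sqr_le_of_norm; rewrite exprMn /seminorm !sqr_sqrtr//.
Qed.

Lemma test_step_difference k a b : 0 < k -> a < b ->
  test_function (fun x => step_at k a x - step_at k b x).
Proof.
move=> k0 ab; have ki0 : 0 < k^-1 by rewrite invr_gt0.
apply: (smooth_support_test _ (a - k^-1) (b + k^-1)).
  have s1 := smooth_step_at k a; have := smoothD _ _ s1 (smooth_affine _ (-1) k (- (k * b)) smoothS).
  by congr smooth; apply/funext => x; rewrite /= mulN1r.
move=> x; rewrite in_itv/= negb_and -!ltNge => /orP[] xab.
  by rewrite !step_at_eq0 ?subrr//; lra.
by rewrite !step_at_eq1 ?subrr//; lra.
Qed.

(* Tested against a smoothed indicator of [[a, b]], whose derivative is the
   difference of two mollifiers. *)
Lemma weak_derivative_increment f g a b :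
  f \in Lfun lam 2%:E -> g \in Lfun lam 2%:E -> weak_derivative f g ->
  a < b -> lebesgue_pt f a -> lebesgue_pt f b ->
  (f b - f a) ^+ 2 <= 2 * (b - a) * \int[lam]_x (g x ^+ 2).
Proof.
move=> f2 g2 fg ab fa fb; set G := \int[lam]_x _.
have G0 : 0 <= G by apply: Rintegral_ge0 => x _; exact: sqr_ge0.
apply/ler_addgt0Pr => e e0.
(* The estimate obtained is 2 G (b - a + 2 d) + 2 (2 d)^2; since d <= 1, its excess 4 G d + 8 d^2 is
   at most d (4 G + 8) <= e. *)
pose d := Num.min 1 (e / (4 * G + 8)).
have d0 : 0 < d by rewrite lt_min ltr01 divr_gt0// ltr_wpDl// mulr_ge0.
have [d1 dG] : d <= 1 /\ d * (4 * G + 8) <= e.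
  split; first by rewrite ge_min lexx.
  by rewrite -ler_pdivlMr ?ge_min ?lexx ?orbT// ltr_wpDl// mulr_ge0.
have [K K0 fK] := mollifier_cvg _ _ _ f2 fa d0.
have [K' K'0 fK'] := mollifier_cvg _ _ _ f2 fb d0.
pose k := Num.max (d^-1) (Num.max K K').
have kd : d^-1 <= k by rewrite le_max lexx.
have {}fK := fK k ltac:(by rewrite !le_max lexx orbT).
have {}fK' := fK' k ltac:(by rewrite !le_max lexx !orbT).
have k0 : 0 < k by rewrite (lt_le_trans _ kd)// invr_gt0.
have ki0 : 0 < k^-1 by rewrite invr_gt0.
have kid : k^-1 <= d by rewrite -[d]invrK lef_pV2// posrE invr_gt0.
have tphi := test_step_difference _ _ _ k0 ab.
have := fg _ tphi; set phi := fun x => _ in tphi *.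
have dphi x : derive1 phi x = mollifier k a x - mollifier k b x.
  rewrite derive1E.
  have dx := is_deriveB (is_derive_step_at k a x) (is_derive_step_at k b x).
  exact: derive_val.
under eq_Rintegral do rewrite dphi mulrBr.
have m2 c : mollifier k c \in Lfun lam 2%:E by exact: test_Lfun2 _ (mollifier_test _ c k0).
rewrite RintegralB//; try exact: Lfun2M.
move: fK fK'; move: (\int[lam]_x (f x * mollifier k a x)) (\int[lam]_x (f x * mollifier k b x)) => A B.
have phi2 := test_Lfun2 _ tphi.
have := cauchy_schwarz_Lfun2 _ _ g2 phi2; rewrite -/G.
move: (\int[lam]_x (g x * phi x)) => I cs Aa Bb ABI.
have phiI : \int[lam]_x (phi x ^+ 2) <= b - a + 2 * d.
  have abk : a - k^-1 <= b + k^-1 by lra.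
  apply: (@le_trans _ _ (\int[lam]_x (1 * \1_(`[a - k^-1, b + k^-1]%classic) x))); last first.
    by rewrite Rintegral_indic_itv//; lra.
  apply: le_Rintegral => //.
  - by have [] := (Lfun2P phi).1 phi2.
  - by under eq_fun do rewrite mul1r; exact: integrable_indic_itv.
  move=> x _; rewrite mul1r indicE mem_setE; have [_|xab] := boolP (x \in `[a - k^-1, b + k^-1]).
    have /andP[? ?] := S01 (k * x + - (k * a)).
    have /andP[? ?] := S01 (k * x + - (k * b)).
    by rewrite /phi /step_at mulr1n; nra.
  rewrite mulr0n; have -> : phi x = 0; last by rewrite expr0n.
  move: xab; rewrite in_itv/= negb_and -!ltNge => /orP[] xab.
    by rewrite /phi !step_at_eq0 ?subrr//; lra.
  by rewrite /phi !step_at_eq1 ?subrr//; lra.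
have I2 : I ^+ 2 <= G * (b - a + 2 * d) by rewrite (le_trans cs)// ler_wpM2l.
have h : `|f b - f a - I| <= 2 * d.
  have -> : f b - f a - I = (A - f a) - (B - f b) by rewrite -[I]opprK -ABI; ring.
  by rewrite (le_trans (ler_normB _ _))// mulr_natl mulr2n lerD.
have h2 : (f b - f a - I) ^+ 2 <= (2 * d) ^+ 2.
  exact: sqr_le_of_norm.
have dd : d ^+ 2 <= d by rewrite expr2 ler_piMl// ltW.
have : (f b - f a) ^+ 2 <= 2 * I ^+ 2 + 2 * (f b - f a - I) ^+ 2.
  by have := sqr_ge0 (f b - f a - 2 * I); nra.
by nra.
Qed.

(* Average the increment estimate over an interval of length [l]. *)
Lemma weak_derivative_sup_step f g l :
  f \in Lfun lam 2%:E -> g \in Lfun lam 2%:E -> weak_derivative f g -> 0 < l ->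
  {ae lam, forall x, f x ^+ 2 <=
    2 / l * \int[lam]_y (f y ^+ 2) + 4 * l * \int[lam]_y (g y ^+ 2)}.
Proof.
move=> f2 g2 fg l0; set F := \int[lam]_y _; set G := \int[lam]_y (g y ^+ 2).
have G0 : 0 <= G by apply: Rintegral_ge0 => x _; exact: sqr_ge0.
have fpt := lebesgue_differentiation (Lfun2_locally_integrable _ f2).
move: (fpt); apply: filterS => b fb.
have bl : b <= b + l by rewrite lerDl ltW.
(* For almost every x in the interval, f(b)^2 <= 2 f(x)^2 + 2 (f(b) - f(x))^2, and the increment
   estimate bounds the last term by 4 l G. *)
have : \int[lam]_x ((f b ^+ 2 - 4 * l * G) * \1_(`[b, b + l]%classic) x) <= \int[lam]_x (2 * f x ^+ 2).
  apply: ae_le_Rintegral.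
  - by apply: integrableZ_EFin; exact: integrable_indic_itv.
  - by apply: integrableZ_EFin; have [] := (Lfun2P f).1 f2.
  move: fpt; apply: filterS => x fx.
  rewrite indicE mem_setE; have [|] := boolP (x \in `[b, b + l]); last first.
    by rewrite mulr0 mulr_ge0// sqr_ge0.
  rewrite in_itv/= mulr1 => /andP[]; rewrite le_eqVlt => /predU1P[<- _|bx xb].
    by have := sqr_ge0 (f b); have := mulr_ge0 (ltW l0) G0; lra.
  have := weak_derivative_increment _ _ _ _ f2 g2 fg bx fb fx; rewrite -/G => h.
  have h3 : (x - b) * G <= l * G by rewrite ler_wpM2r//; lra.
  by have := sqr_ge0 (2 * f x - f b); nra.
rewrite Rintegral_indic_itv// RintegralZl//; last by have [] := (Lfun2P f).1 f2.
rewrite -/F addrAC subrr add0r => h.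
rewrite -lerBlDr -(ler_pM2r l0) (le_trans h)//.
by rewrite mulrAC divfK// gt_eqF.
Qed.

End mollifier.

(** * Uniqueness, sup bound and product rule for weak derivatives *)

Section L2_pairs.
Context {R : realType}.
Local Notation lam := (@lebesgue_measure R).
Local Notation L := (LfunType lam (@one_le2E R)).
Local Notation V := (L * L)%type.
Implicit Types (f g phi : R -> R) (v w : V).

Lemma du_bois_reymond f : f \in Lfun lam 2%:E ->
  (forall phi, test_function phi -> \int[lam]_x (f x * phi x) = 0) ->
  {ae lam, forall x, f x = 0}.
Proof.
have [S [S' [C [sS dS S0 S1 [S01 S'C S'0]]]]] := @smooth_step R.
exact: du_bois_reymond_step sS dS S0 S1 S'C S'0 f.
Qed.

Lemma weak_derivative_sup f g l :
  f \in Lfun lam 2%:E -> g \in Lfun lam 2%:E -> weak_derivative f g -> 0 < l ->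
  {ae lam, forall x, f x ^+ 2 <=
    2 / l * \int[lam]_y (f y ^+ 2) + 4 * l * \int[lam]_y (g y ^+ 2)}.
Proof.
have [S [S' [C [sS dS S0 S1 [S01 S'C S'0]]]]] := @smooth_step R.
exact: weak_derivative_sup_step sS dS S0 S1 S01 S'C S'0 f g l.
Qed.

Lemma weak_derivative_unique f g h : f \in Lfun lam 2%:E -> g \in Lfun lam 2%:E ->
  h \in Lfun lam 2%:E -> weak_derivative f g -> weak_derivative f h ->
  {ae lam, forall x, g x = h x}.
Proof.
move=> f2 g2 h2 fg fh.
have : {ae lam, forall x, g x - h x = 0}.
  apply: du_bois_reymond => [|phi tphi].
    exact: (LfunP (Lfun_Sub one_le2E g2 - Lfun_Sub one_le2E h2)).
  under eq_Rintegral do rewrite mulrBl.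
  have phi2 := test_Lfun2 _ tphi.
  rewrite RintegralB//; try exact: Lfun2M.
  by apply/eqP; rewrite subr_eq0 -eqr_opp -fg// -fh.
by apply: filterS => x /subr0_eq.
Qed.

Lemma weak_derivativeB f f' g g' : f \in Lfun lam 2%:E -> g \in Lfun lam 2%:E ->
  f' \in Lfun lam 2%:E -> g' \in Lfun lam 2%:E ->
  weak_derivative f f' -> weak_derivative g g' ->
  weak_derivative (fun x => f x - g x) (fun x => f' x - g' x).
Proof.
move=> f2 g2 f'2 g'2 ff gg phi tphi.
have phi2 := test_Lfun2 _ tphi; have phi'2 := test_Lfun2 _ (derive1_test _ tphi).
under eq_Rintegral do rewrite mulrBl.
under [in RHS]eq_Rintegral do rewrite mulrBl.
rewrite !RintegralB//; try exact: Lfun2M.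
by rewrite ff// gg//; ring.
Qed.

Lemma weak_derivativeN f f' : f \in Lfun lam 2%:E -> f' \in Lfun lam 2%:E ->
  weak_derivative f f' -> weak_derivative (fun x => - f x) (fun x => - f' x).
Proof.
move=> f2 f'2 ff phi tphi.
have phi2 := test_Lfun2 _ tphi; have phi'2 := test_Lfun2 _ (derive1_test _ tphi).
under eq_Rintegral do rewrite -mulN1r -mulrA.
under [in RHS]eq_Rintegral do rewrite -mulN1r -mulrA.
rewrite !RintegralZl//; try exact: Lfun2M.
by rewrite ff//; ring.
Qed.

Lemma test_functionM phi psi : smooth phi -> test_function psi ->
  test_function (fun x => phi x * psi x).
Proof.
move=> sphi tpsi; have [A A0] := test_support _ tpsi.
apply: (@smooth_support_test _ _ (- A) A); first exact: smoothM (test_smooth _ tpsi).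
by move=> x /A0 ->; rewrite mulr0.
Qed.

Lemma Lfun2_boundedM phi f M : measurable_fun setT phi -> (forall x, `|phi x| <= M) ->
  f \in Lfun lam 2%:E -> (fun x => phi x * f x) \in Lfun lam 2%:E.
Proof.
move=> mphi phiM f2; apply: (Lfun2_dominated _ f M) => //.
  by apply: measurable_funM => //; have [] := (Lfun2P f).1 f2.
by apply: aeW => x; rewrite normrM ler_wpM2r.
Qed.

(** [phi * psi] is again a test function, and the weak derivative of [f] is tested with it; the
    bounds on [phi] and [phi'] make the three resulting products integrable. *)
Lemma weak_derivativeM phi phi' f f' M M' : smooth phi ->
  (forall x : R, is_derive x 1 phi (phi' x)) ->
  (forall x, `|phi x| <= M) -> (forall x, `|phi' x| <= M') ->
  f \in Lfun lam 2%:E -> f' \in Lfun lam 2%:E -> weak_derivative f f' ->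
  weak_derivative (fun x => phi x * f x) (fun x => phi' x * f x + phi x * f' x).
Proof.
move=> sphi dphi phiM phiM' f2 f'2 ff psi tpsi.
have psi2 := test_Lfun2 _ tpsi; have psi'2 := test_Lfun2 _ (derive1_test _ tpsi).
have tpp := test_functionM _ _ sphi tpsi.
have phiE : phi' = derive1 phi.
  by apply/funext => x; rewrite derive1E; apply/esym; apply: derive_val.
have cphi := smooth_continuous _ sphi.
have cphi' : continuous phi' by rewrite phiE; exact/smooth_continuous/smooth_derive1.
have mphi : measurable_fun setT phi by exact: continuous_measurable_fun.
have mphi' : measurable_fun setT phi' by exact: continuous_measurable_fun.
have dpp x : derive1 (fun x => phi x * psi x) x = phi' x * psi x + phi x * derive1 psi x.
  rewrite derive1E; have d1 := is_deriveM (dphi x) (smooth_is_derive _ (test_smooth _ tpsi) x).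
  have -> : phi' x * psi x + phi x * derive1 psi x = phi x * derive1 psi x + psi x * phi' x by ring.
  exact: derive_val.
have := ff _ tpp; under eq_Rintegral do rewrite dpp.
have I1 : lam.-integrable setT (EFin \o (fun x => phi' x * f x * psi x)).
  by apply: Lfun2M => //; exact: Lfun2_boundedM phiM' f2.
have I2 : lam.-integrable setT (EFin \o (fun x => phi x * f x * derive1 psi x)).
  by apply: Lfun2M => //; exact: Lfun2_boundedM phiM f2.
have I3 : lam.-integrable setT (EFin \o (fun x => phi x * f' x * psi x)).
  by apply: Lfun2M => //; exact: Lfun2_boundedM phiM f'2.
have -> : \int[lam]_x (f x * (phi' x * psi x + phi x * derive1 psi x)) =
   \int[lam]_x (phi' x * f x * psi x) + \int[lam]_x (phi x * f x * derive1 psi x).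
  by rewrite -RintegralD//; apply: eq_Rintegral => x _; ring.
have -> : \int[lam]_x (f' x * (phi x * psi x)) = \int[lam]_x (phi x * f' x * psi x).
  by apply: eq_Rintegral => x _; ring.
have -> : \int[lam]_x ((phi' x * f x + phi x * f' x) * psi x) =
   \int[lam]_x (phi' x * f x * psi x) + \int[lam]_x (phi x * f' x * psi x).
  by rewrite -RintegralD//; apply: eq_Rintegral => x _; ring.
by move=> h; lra.
Qed.

End L2_pairs.

(** * Pairs of square integrable functions *)

Section L2_pairs_ip.
Context {R : realType}.
Local Notation lam := (@lebesgue_measure R).
Local Notation L := (LfunType lam (@one_le2E R)).
Local Notation V := (L * L)%type.
Implicit Types (f g phi : R -> R) (v w : V) (F G : R -> R[i]).

(** Complex functions are encoded as pairs of real ones, and this is the real form Re int v conj(w);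
    multiplication by i becomes the map [rot]. *)
Definition ip v w : R := \int[lam]_x (v.1 x * w.1 x + v.2 x * w.2 x).
Definition rot v : V := (- v.2, v.1).
Definition weak_derivative2 v w :=
  weak_derivative v.1 w.1 /\ weak_derivative v.2 w.2.

Lemma LfunTP (f : L) : (f : R -> R) \in Lfun lam 2%:E.
Proof. exact: LfunP. Qed.
Hint Resolve LfunTP : core.

Lemma integrable_ip v w : lam.-integrable setT (EFin \o (fun x => v.1 x * w.1 x + v.2 x * w.2 x)).
Proof. by apply: integrableD_EFin; exact: Lfun2M. Qed.
Hint Resolve integrable_ip : core.

Lemma ip_sym v w : ip v w = ip w v.
Proof. by apply: eq_Rintegral => x _; ring. Qed.

Lemma ip_addl v w z : ip (v + w) z = ip v z + ip w z.
Proof.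
rewrite /ip -RintegralD//; apply: eq_Rintegral => x _.
change ((v.1 x + w.1 x) * z.1 x + (v.2 x + w.2 x) * z.2 x =
  v.1 x * z.1 x + v.2 x * z.2 x + (w.1 x * z.1 x + w.2 x * z.2 x)); ring.
Qed.

Lemma ip_scalel (k : R) v w : ip (k *: v) w = k * ip v w.
Proof.
rewrite /ip -RintegralZl//; apply: eq_Rintegral => x _.
by rewrite mulrDr !mulrA.
Qed.

Lemma ip_self_ge0 v : 0 <= ip v v.
Proof. by apply: Rintegral_ge0 => x _; rewrite -!expr2 addr_ge0// sqr_ge0. Qed.

Lemma rotB v w : rot (v - w) = rot v - rot w.
Proof. by rewrite /rot; congr (_, _) => /=; rewrite opprB addrC opprK. Qed.

Lemma rotK v : rot (rot v) = - v.
Proof. by []. Qed.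

Lemma ip_rot v w : ip (rot v) w = - ip v (rot w).
Proof.
rewrite -mulN1r -RintegralZl//; apply: eq_Rintegral => x _.
change (- v.2 x * w.1 x + v.1 x * w.2 x = -1 * (v.1 x * - w.2 x + v.2 x * w.1 x)); ring.
Qed.

Lemma weak_derivative2B v v' w w' : weak_derivative2 v v' -> weak_derivative2 w w' ->
  weak_derivative2 (v - w) (v' - w').
Proof.
by move=> [v1 v2] [w1 w2]; split;
  [exact: (weak_derivativeB _ _ _ _ (LfunTP _) (LfunTP _) (LfunTP _) (LfunTP _) v1 w1)
  |exact: (weak_derivativeB _ _ _ _ (LfunTP _) (LfunTP _) (LfunTP _) (LfunTP _) v2 w2)].
Qed.

Lemma weak_derivative2_rot v v' : weak_derivative2 v v' -> weak_derivative2 (rot v) (rot v').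
Proof. by move=> [v1 v2]; split => //; exact: (weak_derivativeN _ _ (LfunTP _) (LfunTP _) v2). Qed.

(** Outside L^2 the value is the default 0, so computing with it requires a proof of membership. *)
Definition toL f : L := insubd (0 : L) f.

Lemma toLE f : f \in Lfun lam 2%:E -> (toL f : R -> R) = f.
Proof. by move=> f2; rewrite /toL insubdK. Qed.

Definition toV F : V := (toL (fun x => complex.Re (F x)), toL (fun x => complex.Im (F x))).

Lemma toV1E F : L2 F -> (toV F).1 = (fun x => complex.Re (F x)) :> (R -> R).
Proof. by move=> [F1 F2]; rewrite /= toLE. Qed.

Lemma toV2E F : L2 F -> (toV F).2 = (fun x => complex.Im (F x)) :> (R -> R).
Proof. by move=> [F1 F2]; rewrite /= toLE. Qed.

Definition ofV v : R -> R[i] := fun x => (v.1 x +i* v.2 x)%C.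

Lemma L2_ofV v : L2 (ofV v).
Proof. by split; rewrite /= LfunTP. Qed.

Lemma is_weak_derivativeE F G : is_weak_derivative F G <-> [/\ L2 G,
  weak_derivative (fun x => complex.Re (F x)) (fun x => complex.Re (G x)) &
  weak_derivative (fun x => complex.Im (F x)) (fun x => complex.Im (G x))].
Proof.
have E (h : R -> R[i]) phi : cintegral (fun x => h x * (phi x)%:C%C) =
    (\int[lam]_x (complex.Re (h x) * phi x) +i* \int[lam]_x (complex.Im (h x) * phi x))%C.
  by congr (_ +i* _)%C; apply: eq_Rintegral => x _; case: (h x) => a b /=; ring.
split=> [[G2 FG]|[G2 FG1 FG2]]; split => //.
- by move=> phi tphi; have := FG phi tphi; rewrite !E => -[].
- by move=> phi tphi; have := FG phi tphi; rewrite !E => -[].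
by move=> phi tphi; rewrite !E FG1// FG2.
Qed.

Lemma wderivP F : H1 F -> is_weak_derivative F (wderiv F).
Proof. by move=> [_ [g Fg]]; apply: (@xgetPex _ _ [set g | is_weak_derivative F g]); exists g. Qed.

Lemma wderiv_L2 F : H1 F -> L2 (wderiv F).
Proof. by move=> /wderivP[]. Qed.

Lemma weak_derivative2_wderiv F : H1 F -> weak_derivative2 (toV F) (toV (wderiv F)).
Proof.
move=> hF; have [F2 _] := hF; have /is_weak_derivativeE[G2 h1 h2] := wderivP _ hF.
by split; rewrite ?toV1E ?toV2E.
Qed.

Lemma H1_ofV v v' : weak_derivative2 v v' -> H1 (ofV v).
Proof.
move=> [v1 v2]; split; first exact: L2_ofV.
by exists (ofV v'); apply/is_weak_derivativeE; split => //; exact: L2_ofV.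
Qed.

Lemma toV_ofV v : toV (ofV v) = v.
Proof.
by rewrite [RHS]surjective_pairing; congr (_, _); apply/LfuneqP => x; rewrite toLE//= LfunTP.
Qed.

(** Two weak derivatives agree almost everywhere but may differ as functions, so uniqueness is
    expressed through the inner product. *)
Lemma weak_derivative2_unique v w w' : weak_derivative2 v w -> weak_derivative2 v w' ->
  forall z, ip w z = ip w' z.
Proof.
move=> [w1 w2] [w'1 w'2] z; apply: ae_eq_Rintegral => //.
  exact: integrable_measurable.
have := weak_derivative_unique _ _ _ (LfunTP _) (LfunTP _) (LfunTP _) w1 w'1.
have := weak_derivative_unique _ _ _ (LfunTP _) (LfunTP _) (LfunTP _) w2 w'2.
by apply: filterS2 => x -> ->.
Qed.

Lemma weak_derivative2_sup v w l : weak_derivative2 v w -> 0 < l ->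
  {ae lam, forall x, v.1 x ^+ 2 + v.2 x ^+ 2 <= 2 / l * ip v v + 4 * l * ip w w}.
Proof.
move=> [v1 v2] l0.
have i2 (f : L) : lam.-integrable setT (EFin \o (fun x => f x ^+ 2)).
  by have [] := (Lfun2P f).1 (LfunTP f).
have ipE u : ip u u = \int[lam]_x (u.1 x ^+ 2) + \int[lam]_x (u.2 x ^+ 2).
  by rewrite -RintegralD.
have := weak_derivative_sup _ _ _ (LfunTP _) (LfunTP _) v1 l0.
have := weak_derivative_sup _ _ _ (LfunTP _) (LfunTP _) v2 l0.
by apply: filterS2 => x h1 h2; rewrite !ipE !mulrDr; lra.
Qed.

End L2_pairs_ip.

(** * The norms and the equation in terms of the real inner product *)

Section norms.
Context {R : realType}.
Local Notation lam := (@lebesgue_measure R).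
Local Notation L := (LfunType lam (@one_le2E R)).
Local Notation V := (L * L)%type.
Implicit Types (v w : V) (F G : R -> R[i]) (D : set R).

Lemma integrable_indic_sqr D F : measurable D -> L2 F ->
  lam.-integrable setT (EFin \o (fun x => \1_D x * (complex.Re (F x) ^+ 2 + complex.Im (F x) ^+ 2))).
Proof.
move=> mD [/Lfun2P[m1 i1] /Lfun2P[m2 i2]].
apply: (integrable_dominated _ _ _ (integrableD_EFin _ _ i1 i2)).
  apply: measurable_funM; first exact: measurable_indic.
  by apply: measurable_funD; exact: measurable_funX.
apply: aeW => x; rewrite normrM [X in _ * X]ger0_norm ?addr_ge0 ?sqr_ge0//.
rewrite ler_piMl ?addr_ge0 ?sqr_ge0// indicE; case: (x \in D); rewrite ?normr1 ?normr0//.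
Qed.

Lemma L2normE D F : measurable D -> L2 F -> L2norm D F =
  (Num.sqrt (\int[lam]_x (\1_D x * (complex.Re (F x) ^+ 2 + complex.Im (F x) ^+ 2))))%:E.
Proof.
move=> mD F2; have i := integrable_indic_sqr _ _ mD F2.
rewrite /L2norm unlock /Lnorm -powR12_sqrt; last first.
  apply: Rintegral_ge0 => x _; rewrite mulr_ge0 ?addr_ge0 ?sqr_ge0//.
rewrite -poweR_EFin /Rintegral fineK; last exact: integrable_fin_num.
congr (_ `^ _)%E; apply: eq_integral => x _.
rewrite patchE indicE; case: (x \in D) => /=; last first.
  by rewrite normr0 mul0r powR0 ?pnatr_eq0.
rewrite mul1r powR_mulrn// real_normK ?num_real//.
by case: (F x) => a b /=; rewrite sqr_sqrtr// addr_ge0// sqr_ge0.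
Qed.

Lemma ip_toV F : L2 F -> ip (toV F) (toV F) =
  \int[lam]_x (complex.Re (F x) ^+ 2 + complex.Im (F x) ^+ 2).
Proof.
by move=> F2; apply: eq_Rintegral => x _; rewrite toV1E// toV2E// -!expr2.
Qed.

Lemma L2normTE F : L2 F -> L2norm setT F = (seminorm (ip := ip) (toV F))%:E.
Proof.
move=> F2; rewrite L2normE// /seminorm ip_toV//; congr (Num.sqrt _)%:E.
by apply: eq_Rintegral => x _; rewrite indicE in_setT mul1r.
Qed.

Lemma H1normE F : H1 F -> H1norm F =
  (Num.sqrt (ip (toV F) (toV F) + ip (toV (wderiv F)) (toV (wderiv F))))%:E.
Proof.
move=> hF; have [F2 _] := hF; have G2 := wderiv_L2 _ hF.
rewrite /H1norm !L2normTE// -!EFin_expe -EFinD poweR_EFin powR12_sqrt.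
  by rewrite /seminorm !sqr_sqrtr// ip_self_ge0.
by rewrite addr_ge0// sqr_ge0.
Qed.

Lemma toVB F G : L2 F -> L2 G -> toV (fun x => F x - G x) = toV F - toV G.
Proof.
move=> [F1 F2] [G1 G2].
have BRe x : complex.Re (F x - G x) = complex.Re (F x) - complex.Re (G x).
  by case: (F x) => a b; case: (G x).
have BIm x : complex.Im (F x - G x) = complex.Im (F x) - complex.Im (G x).
  by case: (F x) => a b; case: (G x).
rewrite /toV; under eq_fun do rewrite BRe; under [in X in (_, X)]eq_fun do rewrite BIm.
have sub f g : f \in Lfun lam 2%:E -> g \in Lfun lam 2%:E ->
    toL (fun x => f x - g x) = toL f - toL g.
  move=> f2 g2; apply/LfuneqP => x; rewrite toLE.
    by change (f x - g x = toL f x - toL g x); rewrite !toLE.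
  exact: (LfunP (Lfun_Sub one_le2E f2 - Lfun_Sub one_le2E g2)).
by congr (_, _); exact: sub.
Qed.

Lemma ofV_toVB F G : L2 F -> L2 G -> ofV (toV F - toV G) = (fun x => F x - G x).
Proof.
move=> F2 G2; apply/funext => x.
change ((((toV F).1 x - (toV G).1 x) +i* ((toV F).2 x - (toV G).2 x))%C = F x - G x).
rewrite !toV1E// !toV2E//.
by case: (F x) => a b; case: (G x).
Qed.

Lemma H1B F G : H1 F -> H1 G -> H1 (fun x => F x - G x).
Proof.
move=> hF hG; rewrite -ofV_toVB; try by case: hF hG => [? _] [? _].
apply: H1_ofV; exact: weak_derivative2B (weak_derivative2_wderiv _ hF) (weak_derivative2_wderiv _ hG).
Qed.

(** [wderiv] of a difference is a choice made independently of the choices for [F] and [G];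
    uniqueness of weak derivatives, applied in both arguments, identifies the squared norms. *)
Lemma ip_wderivB F G : H1 F -> H1 G ->
  ip (toV (wderiv F) - toV (wderiv G)) (toV (wderiv F) - toV (wderiv G)) =
  ip (toV (wderiv (fun x => F x - G x))) (toV (wderiv (fun x => F x - G x))).
Proof.
move=> hF hG; have [F2 _] := hF; have [G2 _] := hG.
have d1 := weak_derivative2B _ _ _ _ (weak_derivative2_wderiv _ hF) (weak_derivative2_wderiv _ hG).
have d2 := weak_derivative2_wderiv _ (H1B _ _ hF hG); rewrite toVB// in d2.
by rewrite (weak_derivative2_unique _ _ _ d1 d2) ip_sym (weak_derivative2_unique _ _ _ d1 d2).
Qed.

(** The H^1 norm dominates both seminorms, and for t > 0 the restriction to times s >= 0 disappears
    near t. *)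
Lemma continuous_H1_seminorm (u : R -> R -> R[i]) t : continuous_H1 u -> 0 < t ->
  seminorm (ip := ip) (toV (u s) - toV (u t)) @[s --> t] --> 0 /\
  seminorm (ip := ip) (toV (wderiv (u s)) - toV (wderiv (u t))) @[s --> t] --> 0.
Proof.
move=> [hu cu] t0; have ut := hu _ (ltW t0).
have near_bnd e : 0 < e -> \forall s \near t,
    seminorm (ip := ip) (toV (u s) - toV (u t)) <= e /\
    seminorm (ip := ip) (toV (wderiv (u s)) - toV (wderiv (u t))) <= e.
  move=> e0; have := near_lt_of_cvge0 _ _ (cu t (ltW t0)) e0.
  rewrite near_withinE => h; near=> s.
  have s0 : 0 <= s by near: s; apply: filterS (lt_nbhsr t0) => ? /ltW.
  have us := hu _ s0; have [us2 _] := us; have [ut2 _] := ut.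
  have : (H1norm (fun x => (u s x - u t x)%R) < e%:E)%E by move: s0; near: s; exact: h.
  rewrite H1normE; last exact: H1B.
  rewrite lte_fin toVB// -ip_wderivB// => /ltW se.
  split; rewrite (le_trans _ se)// ler_sqrt ?addr_ge0 ?ip_self_ge0//.
    by rewrite lerDl ip_self_ge0.
  by rewrite lerDr ip_self_ge0.
split; apply/cvgrPdist_le => e e0; have := near_bnd _ e0; apply: filterS => s [h1 h2].
  by rewrite sub0r normrN (ger0_norm (seminorm_ge0 _)).
by rewrite sub0r normrN (ger0_norm (seminorm_ge0 _)).
Unshelve. all: by end_near. Qed.

(* With [v := i * conj w], the imaginary part of the pairing [int u v] is the
   real inner product of [u] and [w]. *)
Lemma is_derive_ip_solution (eps p : R) (u : R -> R -> R[i]) t w w' :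
  (forall s, 0 <= s -> H1 (u s)) -> solves_NLS eps p u -> 0 < t ->
  L2 (fun x => power_nonlinearity p (u t x)) -> weak_derivative2 w w' ->
  is_derive t 1 (fun s => ip (toV (u s)) w)
    (ip (toV (wderiv (u t))) (rot w') -
     eps * ip (toV (fun x => power_nonlinearity p (u t x))) (rot w)).
Proof.
move=> hu sol t0 N2 ww'.
pose z : V := (w.2, w.1); pose z' : V := (w'.2, w'.1).
have zz' : weak_derivative2 z z' by case: ww'.
have hz := H1_ofV _ _ zz'.
have [d [_ dIm] deq] := sol t (ofV z) t0 hz.
have dE : complex.Im d = - complex.Re (pairing (wderiv (u t)) (wderiv (ofV z))) +
    eps * complex.Re (pairing (fun x => power_nonlinearity p (u t x)) (ofV z)).
  (* Real part of the equation, where Re (i d) = - Im d. *)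
  have := congr1 (@complex.Re R) deq.
  case: d {dIm deq} => a b; case: (pairing _ _) => a1 b1; case: (pairing _ _) => a2 b2 /=.
  by rewrite /= => h; lra.
have D2 := wderiv_L2 _ (hu _ (ltW t0)).
have Dz2 := wderiv_L2 _ hz.
have pE F G : complex.Re (pairing F G) =
    \int[lam]_x (complex.Re (F x) * complex.Re (G x) - complex.Im (F x) * complex.Im (G x)).
  by apply: eq_Rintegral => x _; case: (F x) => ? ?; case: (G x).
have -> : ip (toV (wderiv (u t))) (rot w') = - complex.Re (pairing (wderiv (u t)) (wderiv (ofV z))).
  have := weak_derivative2_wderiv _ hz; rewrite toV_ofV => zz''.
  pose c : V := (toV (wderiv (u t))).
  (* Both [z'] and the chosen [wderiv (ofV z)] are weak derivatives of [z]. Pairing with conj(c)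
     exchanges one for the other and turns [ip] into the pairing without conjugation. *)
  have := weak_derivative2_unique _ _ _ zz' zz'' (c.1, - c.2).
  rewrite pE => h.
  transitivity (- ip z' (c.1, - c.2)).
    rewrite -[RHS]mulN1r -RintegralZl; [|by []|exact: integrable_ip].
    apply: eq_Rintegral => x _; change (c.1 x * - w'.2 x + c.2 x * w'.1 x =
      -1 * (w'.2 x * c.1 x + w'.1 x * - c.2 x)); ring.
  rewrite h; congr (- _); apply: eq_Rintegral => x _.
  change ((toV (wderiv (ofV z))).1 x * c.1 x + (toV (wderiv (ofV z))).2 x * - c.2 x =
    complex.Re (wderiv (u t) x) * complex.Re (wderiv (ofV z) x) -
    complex.Im (wderiv (u t) x) * complex.Im (wderiv (ofV z) x)).
  (* Rewriting with [e1], ..., [e4] would compare the two derivatives up to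
     conversion, which is very slow. *)
  have e1 : c.1 x = complex.Re (wderiv (u t) x) by rewrite /c (toV1E _ D2).
  have e2 : c.2 x = complex.Im (wderiv (u t) x) by rewrite /c (toV2E _ D2).
  have e3 : (toV (wderiv (ofV z))).1 x = complex.Re (wderiv (ofV z) x) by rewrite (toV1E _ Dz2).
  have e4 : (toV (wderiv (ofV z))).2 x = complex.Im (wderiv (ofV z) x) by rewrite (toV2E _ Dz2).
  have alg (a a' b b' k k' l l' : R) : a = a' -> b = b' -> k = k' -> l = l' ->
      k * a + l * - b = a' * k' - b' * l' by move=> -> -> -> ->; ring.
  exact: alg e1 e2 e3 e4.
have -> : ip (toV (fun x => power_nonlinearity p (u t x))) (rot w) =
    - complex.Re (pairing (fun x => power_nonlinearity p (u t x)) (ofV z)).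
  rewrite pE; pose c : V := toV (fun x => power_nonlinearity p (u t x)).
  transitivity (- ip (c.1, - c.2) z).
    rewrite -[RHS]mulN1r -RintegralZl; [|by []|exact: integrable_ip].
    apply: eq_Rintegral => x _; change (c.1 x * - w.2 x + c.2 x * w.1 x =
      -1 * (c.1 x * w.2 x + - c.2 x * w.1 x)); ring.
  congr (- _); apply: eq_Rintegral => x _.
  change (c.1 x * w.2 x + - c.2 x * w.1 x =
    complex.Re (power_nonlinearity p (u t x)) * w.2 x -
    complex.Im (power_nonlinearity p (u t x)) * w.1 x).
  by rewrite /c !toV1E// !toV2E// mulNr.
rewrite mulrN opprK -dE.
apply: near_eq_is_derive dIm; near=> s.
have s0 : 0 <= s by near: s; apply: filterS (lt_nbhsr t0) => ? /ltW.
have [us2 _] := hu _ s0.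
apply: eq_Rintegral => x _.
rewrite toV1E// toV2E//; case: (u s x) => a b /=.
by rewrite addrC.
Unshelve. all: by end_near. Qed.

End norms.

(** * The nonlinearity *)

Section nonlinearity.
Context {R : realType}.
Local Notation lam := (@lebesgue_measure R).
Local Notation L := (LfunType lam (@one_le2E R)).
Local Notation V := (L * L)%type.
Implicit Types (v w : V) (F G : R -> R[i]) (x y a b c d M : R).

(** Young's inequality with exponents m / (m - 1) and m, multiplied by m to clear denominators. *)
Lemma young_powR m x y : 1 < m -> 0 <= x -> 0 <= y ->
  m * (x `^ (m - 1) * y) <= y `^ m + (m - 1) * x `^ m.
Proof.
move=> m1 x0 y0; have m0 : 0 < m := lt_trans ltr01 m1.
have m10 : 0 < m - 1 by rewrite subr_gt0.
have mN : m != 0 by rewrite gt_eqF.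
have m1N : m - 1 != 0 by rewrite gt_eqF.
have q0 : 0 < m / (m - 1) by rewrite divr_gt0.
have := @conjugate_powR R y (x `^ (m - 1)) m (m / (m - 1)) y0 (powR_ge0 _ _) m0 q0.
rewrite -powRrM (_ : (m - 1) * (m / (m - 1)) = m); last by field.
rewrite [y * x `^ _]mulrC => h.
have {}h : x `^ (m - 1) * y <= y `^ m / m + x `^ m / (m / (m - 1)).
  by apply: h; rewrite invf_div; field.
have := ler_wpM2l (ltW m0) h.
by congr (_ <= _); field; rewrite ?mN ?m1N.
Qed.

Lemma powRB1M m x : 0 <= x -> 1 < m -> x `^ (m - 1) * x = x `^ m.
Proof. by move=> x0 m1; rewrite mulrC mulr_powRB1// (lt_trans _ m1). Qed.

(** This replaces the mean value theorem for the power m - 1, whose derivative is unbounded near 0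
    when m < 2; the factor [y] removes the singularity. The upper bound is the sum of Young's
    inequality and x^(m-1) y <= x^m. *)
Lemma powRB1_diff m x y : 1 < m -> 0 <= y -> y <= x ->
  0 <= (x `^ (m - 1) - y `^ (m - 1)) * y <= m * x `^ (m - 1) * (x - y).
Proof.
move=> m1 y0 yx; have x0 := le_trans y0 yx; apply/andP; split.
  rewrite mulr_ge0// subr_ge0 ge0_ler_powR// ?nnegrE// subr_ge0; exact: ltW.
have h := young_powR _ _ _ m1 x0 y0.
rewrite mulrBl powRB1M//.
have hx := powRB1M _ _ x0 m1.
have : x `^ (m - 1) * y <= x `^ (m - 1) * x by rewrite ler_wpM2l// powR_ge0.
have -> : m * x `^ (m - 1) * (x - y) = m * (x `^ (m - 1) * x) - m * (x `^ (m - 1) * y) by ring.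
rewrite hx => h2; lra.
Qed.

Lemma sqr_normc (z : R[i]) : Normc.normc z ^+ 2 = complex.Re z ^+ 2 + complex.Im z ^+ 2.
Proof. by case: z => a b /=; rewrite sqr_sqrtr// addr_ge0 ?sqr_ge0. Qed.

Lemma normc_nonneg (z : R[i]) : 0 <= Normc.normc z.
Proof. by case: z => a b; exact: sqrtr_ge0. Qed.

Lemma nonlinearity_Re p (z : R[i]) : complex.Re (power_nonlinearity p z) =
  Normc.normc z `^ (p - 1) * complex.Re z.
Proof. by case: z => a b; rewrite /power_nonlinearity /=; ring. Qed.

Lemma nonlinearity_Im p (z : R[i]) : complex.Im (power_nonlinearity p z) =
  Normc.normc z `^ (p - 1) * complex.Im z.
Proof. by case: z => a b; rewrite /power_nonlinearity /=; ring. Qed.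

Lemma normc_dot (z t : R[i]) :
  complex.Re z * complex.Re t + complex.Im z * complex.Im t <= Normc.normc z * Normc.normc t.
Proof.
apply: le_trans (ler_norm _) _; rewrite -ler_sqr ?nnegrE ?mulr_ge0 ?normc_nonneg//.
rewrite real_normK ?num_real// exprMn !sqr_normc.
have := sqr_ge0 (complex.Re z * complex.Im t - complex.Im z * complex.Re t); nra.
Qed.

Definition dist2 (z t : R[i]) : R :=
  (complex.Re z - complex.Re t) ^+ 2 + (complex.Im z - complex.Im t) ^+ 2.

Lemma dist2C z t : dist2 z t = dist2 t z.
Proof. by rewrite /dist2; ring. Qed.

(** For |t| <= |z| the difference is |z|^(p-1) (z - t) + (|z|^(p-1) - |t|^(p-1)) t, and
    [powRB1_diff] bounds the second term by p |z|^(p-1) |z - t|. Squaring the sum gives the constant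
    2 + 2 p^2. *)
Lemma nonlinearity_lipschitz p M (z t : R[i]) : 1 < p ->
  Normc.normc z <= M -> Normc.normc t <= M ->
  dist2 (power_nonlinearity p z) (power_nonlinearity p t) <=
    (2 + 2 * p ^+ 2) * (M `^ (p - 1)) ^+ 2 * dist2 z t.
Proof.
move=> p1; wlog tz : z t / Normc.normc t <= Normc.normc z => [wl|zM tM].
  have /orP[|] := le_total (Normc.normc t) (Normc.normc z); first exact: wl.
  by move=> zt zM tM; rewrite dist2C [dist2 z t]dist2C; exact: wl.
have z0 := normc_nonneg z; have t0 := normc_nonneg t.
have M0 := le_trans z0 zM.
have /andP[d0 d1] := powRB1_diff _ _ _ p1 t0 tz.
have zd := normc_dot z t; have nz := sqr_normc z; have nt := sqr_normc t.
rewrite /dist2 !nonlinearity_Re !nonlinearity_Im.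
move: zd nz nt d0 d1 tz z0 t0 zM tM; case: z => a b; case: t => c d.
rewrite [complex.Re _]/= [complex.Im _]/= [complex.Re _]/= [complex.Im _]/=.
move: (Normc.normc _) (Normc.normc _) => s r.
move=> zd nz nt d0 d1 tz z0 t0 zM tM.
have rM : r `^ (p - 1) <= M `^ (p - 1).
  by rewrite ge0_ler_powR// ?nnegrE// subr_ge0 ltW.
have r0 := powR_ge0 r (p - 1).
move: (r `^ (p - 1)) (s `^ (p - 1)) (M `^ (p - 1)) rM r0 d0 d1 => A B K AK A0 d0 d1.
pose q := (a - c) ^+ 2 + (b - d) ^+ 2.
have q0 : 0 <= q by rewrite addr_ge0 ?sqr_ge0.
have rs : (r - s) ^+ 2 <= q by rewrite /q; nra.
have h1 : ((A - B) * s) ^+ 2 <= (p * A * (r - s)) ^+ 2.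
  by rewrite ler_sqr ?nnegrE// (le_trans d0 d1).
have h2 : (p * A * (r - s)) ^+ 2 <= p ^+ 2 * A ^+ 2 * q.
  by rewrite !exprMn ler_wpM2l// mulr_ge0 ?sqr_ge0.
have h3 : (A * a - B * c) ^+ 2 + (A * b - B * d) ^+ 2 <= 2 * A ^+ 2 * q + 2 * ((A - B) * s) ^+ 2.
  rewrite [((A - B) * s) ^+ 2]exprMn nt /q.
  have := sqr_ge0 (A * (a - c) - (A - B) * c).
  have := sqr_ge0 (A * (b - d) - (A - B) * d).
  nra.
have h4 : A ^+ 2 * q <= K ^+ 2 * q.
  by rewrite ler_wpM2r// ler_sqr ?nnegrE// (le_trans A0).
have h5 : p ^+ 2 * (A ^+ 2 * q) <= p ^+ 2 * (K ^+ 2 * q).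
  by rewrite ler_wpM2l// sqr_ge0.
rewrite -/q; apply: (le_trans h3).
have -> : (2 + 2 * p ^+ 2) * K ^+ 2 * q = 2 * (K ^+ 2 * q) + 2 * (p ^+ 2 * (K ^+ 2 * q)) by ring.
move: h1 h2 h4 h5; rewrite -[p ^+ 2 * A ^+ 2 * q]mulrA.
move: (p ^+ 2 * _) => X; lra.
Qed.

Lemma measurable_normc F : L2 F -> measurable_fun setT (fun x => Normc.normc (F x)).
Proof.
move=> [/Lfun2P[m1 _] /Lfun2P[m2 _]].
have -> : (fun x => Normc.normc (F x)) =
    Num.sqrt \o (fun x => complex.Re (F x) ^+ 2 + complex.Im (F x) ^+ 2).
  by apply/funext => x /=; case: (F x).
apply: measurableT_comp.
  exact: continuous_measurable_fun (@sqrt_continuous R).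
by apply: measurable_funD; exact: measurable_funX.
Qed.

Lemma nonlinearity_L2 p F M : 1 < p -> L2 F ->
  {ae lam, forall x, Normc.normc (F x) <= M} -> L2 (fun x => power_nonlinearity p (F x)).
Proof.
move=> p1 F2 FM; have mF := measurable_normc _ F2; have [F21 F22] := F2.
have mpow : measurable_fun setT (fun x => Normc.normc (F x) `^ (p - 1)).
  exact: (measurableT_comp (measurable_powR _) mF).
have bnd x : Normc.normc (F x) <= M -> `|Normc.normc (F x) `^ (p - 1)| <= M `^ (p - 1).
  move=> xM; have x0 := normc_nonneg (F x); rewrite ger0_norm ?powR_ge0//.
  by rewrite ge0_ler_powR// ?nnegrE ?subr_ge0 ?(ltW p1)// (le_trans x0).
split.
- under eq_fun do rewrite nonlinearity_Re.
  apply: (Lfun2_dominated _ _ (M `^ (p - 1)) _ F21).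
    by apply: measurable_funM => //; have [] := (Lfun2P _).1 F21.
  by move: FM; apply: filterS => x /bnd xM; rewrite normrM ler_wpM2r.
- under eq_fun do rewrite nonlinearity_Im.
  apply: (Lfun2_dominated _ _ (M `^ (p - 1)) _ F22).
    by apply: measurable_funM => //; have [] := (Lfun2P _).1 F22.
  by move: FM; apply: filterS => x /bnd xM; rewrite normrM ler_wpM2r.
Qed.

(** The length [l] stays free: [l = 1] gives boundedness of H^1 functions, and a length depending on
    the gradient gives the Gagliardo-Nirenberg inequality. *)
Lemma H1_sup F l : H1 F -> 0 < l -> {ae lam, forall x, Normc.normc (F x) ^+ 2 <=
  2 / l * ip (toV F) (toV F) + 4 * l * ip (toV (wderiv F)) (toV (wderiv F))}.
Proof.
move=> hF l0; have [F2 _] := hF.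
have := weak_derivative2_sup _ _ _ (weak_derivative2_wderiv _ hF) l0.
by apply: filterS => x; rewrite sqr_normc toV1E// toV2E.
Qed.

Lemma H1_bounded F : H1 F -> {ae lam, forall x, Normc.normc (F x) <=
  Num.sqrt (2 * ip (toV F) (toV F) + 4 * ip (toV (wderiv F)) (toV (wderiv F)))}.
Proof.
move=> hF; have := H1_sup _ _ hF ltr01.
apply: filterS => x; rewrite divr1 mulr1 => h.
have n0 := normc_nonneg (F x).
by rewrite -[leLHS]ger0_norm// -sqrtr_sqr ler_wsqrtr.
Qed.

Lemma nonlinearity_H1_L2 p F : 1 < p -> H1 F -> L2 (fun x => power_nonlinearity p (F x)).
Proof. by move=> p1 hF; have [F2 _] := hF; exact: nonlinearity_L2 p1 F2 (H1_bounded _ hF). Qed.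

Lemma ip_nonlinearity_lipschitz p F G M : 1 < p -> L2 F -> L2 G ->
  {ae lam, forall x, Normc.normc (F x) <= M} ->
  {ae lam, forall x, Normc.normc (G x) <= M} ->
  let N := toV (fun x => power_nonlinearity p (F x)) - toV (fun x => power_nonlinearity p (G x)) in
  ip N N <= (2 + 2 * p ^+ 2) * (M `^ (p - 1)) ^+ 2 * ip (toV F - toV G) (toV F - toV G).
Proof.
move=> p1 F2 G2 FM GM /=.
have NF2 := nonlinearity_L2 _ _ _ p1 F2 FM; have NG2 := nonlinearity_L2 _ _ _ p1 G2 GM.
have E (f g : R -> R[i]) x : L2 f -> L2 g ->
    (toV f - toV g).1 x * (toV f - toV g).1 x + (toV f - toV g).2 x * (toV f - toV g).2 x =
    dist2 (f x) (g x).
  move=> f2 g2; change (((toV f).1 x - (toV g).1 x) * ((toV f).1 x - (toV g).1 x) +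
   ((toV f).2 x - (toV g).2 x) * ((toV f).2 x - (toV g).2 x) = dist2 (f x) (g x)).
  by rewrite !toV1E// !toV2E.
rewrite [X in _ <= _ * X]/ip -RintegralZl//; last exact: integrable_ip.
apply: ae_le_Rintegral.
- exact: integrable_ip.
- by apply: integrableZ_EFin; exact: integrable_ip.
move: FM GM; apply: filterS2 => x Fx Gx.
by rewrite !E//; exact: nonlinearity_lipschitz.
Qed.

(** The left side is at most |z|^p |t|, to which Young's inequality with exponent p + 1 applies; the
    two expressions on the right are multiples of |z|^(p+1) and |t|^(p+1). *)
Lemma nonlinearity_young p (z t : R[i]) : 1 < p ->
  complex.Re (power_nonlinearity p z) * complex.Re t +
  complex.Im (power_nonlinearity p z) * complex.Im t <=
  p / (p + 1) * (complex.Re (power_nonlinearity p z) * complex.Re z +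
    complex.Im (power_nonlinearity p z) * complex.Im z) +
  (p + 1)^-1 * (complex.Re (power_nonlinearity p t) * complex.Re t +
    complex.Im (power_nonlinearity p t) * complex.Im t).
Proof.
move=> p1; rewrite !nonlinearity_Re !nonlinearity_Im.
have z0 := normc_nonneg z; have t0 := normc_nonneg t.
have pot (y : R[i]) : Normc.normc y `^ (p - 1) * complex.Re y * complex.Re y +
    Normc.normc y `^ (p - 1) * complex.Im y * complex.Im y = Normc.normc y `^ (p + 1).
  have y0 := normc_nonneg y.
  transitivity (Normc.normc y `^ (p - 1) * Normc.normc y ^+ 2).
    by rewrite sqr_normc; ring.
  rewrite expr2 mulrA powRB1M//.
  have := powRB1M (p + 1) _ y0; rewrite addrK; apply.
  by rewrite (lt_trans p1)// ltrDl.
rewrite !pot.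
apply: (@le_trans _ _ (Normc.normc z `^ p * Normc.normc t)).
  have -> : Normc.normc z `^ p = Normc.normc z `^ (p - 1) * Normc.normc z by rewrite powRB1M.
  rewrite -!mulrA -mulrDr ler_wpM2l ?powR_ge0//; exact: normc_dot.
have p11 : 1 < p + 1 by rewrite (lt_trans p1)// ltrDl.
have p10 : 0 < p + 1 := lt_trans ltr01 p11.
have := young_powR _ _ _ p11 z0 t0; rewrite addrK => h.
rewrite -(ler_pM2l p10) (le_trans h)//.
by rewrite le_eqVlt; apply/orP; left; apply/eqP; field; rewrite gt_eqF.
Qed.

Lemma ip_nonlinearity_young p F G : 1 < p -> L2 F -> L2 G ->
  L2 (fun x => power_nonlinearity p (F x)) -> L2 (fun x => power_nonlinearity p (G x)) ->
  ip (toV (fun x => power_nonlinearity p (F x))) (toV G) <=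
  p / (p + 1) * ip (toV (fun x => power_nonlinearity p (F x))) (toV F) +
  (p + 1)^-1 * ip (toV (fun x => power_nonlinearity p (G x))) (toV G).
Proof.
move=> p1 F2 G2 NF2 NG2.
rewrite -ip_scalel -[(p + 1)^-1 * _]ip_scalel.
set a := toV (fun x => power_nonlinearity p (F x)).
set b := toV (fun x => power_nonlinearity p (G x)).
rewrite /ip -RintegralD//; try exact: integrable_ip.
apply: le_Rintegral => //; [exact: integrable_ip|by apply: integrableD_EFin; exact: integrable_ip|].
move=> x _.
change (a.1 x * (toV G).1 x + a.2 x * (toV G).2 x <=
  (p / (p + 1) * a.1 x * (toV F).1 x + p / (p + 1) * a.2 x * (toV F).2 x) +
  ((p + 1)^-1 * b.1 x * (toV G).1 x + (p + 1)^-1 * b.2 x * (toV G).2 x)).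
rewrite /a /b !toV1E// !toV2E//; have := nonlinearity_young _ (F x) (G x) p1.
by congr (_ <= _); ring.
Qed.

(** Pointwise, |F|^(p+1) = (|F|^2)^((p-1)/2) |F|^2, and the sup bound controls the first factor. *)
Lemma ip_nonlinearity_pot p F B : 1 < p -> L2 F ->
  L2 (fun x => power_nonlinearity p (F x)) ->
  {ae lam, forall x, Normc.normc (F x) ^+ 2 <= B} ->
  ip (toV (fun x => power_nonlinearity p (F x))) (toV F) <=
   B `^ ((p - 1) / 2) * ip (toV F) (toV F).
Proof.
move=> p1 F2 NF2 FB.
rewrite [X in _ <= _ * X]/ip -RintegralZl//; last exact: integrable_ip.
apply: ae_le_Rintegral.
- exact: integrable_ip.
- by apply: integrableZ_EFin; exact: integrable_ip.
move: FB; apply: filterS => x xB.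
rewrite !toV1E// !toV2E// nonlinearity_Re nonlinearity_Im -!mulrA -mulrDr -!expr2.
rewrite ler_wpM2r ?addr_ge0 ?sqr_ge0//.
have n0 := normc_nonneg (F x).
have -> : Normc.normc (F x) `^ (p - 1) = (Normc.normc (F x) ^+ 2) `^ ((p - 1) / 2).
  by rewrite -powR_mulrn// -powRrM; congr (_ `^ _); field.
rewrite ge0_ler_powR ?nnegrE ?sqr_ge0//.
  by rewrite divr_ge0// subr_ge0 ltW.
by rewrite (le_trans _ xB)// sqr_ge0.
Qed.

End nonlinearity.

(** * Solutions of the equation *)

(** For G > 1 both [E] and [k * P] are bounded by multiples of G^a, so G^(1-a) <= |E| + c. Only the
    size of [k] enters, so both signs of the nonlinearity are treated alike. *)
Lemma sublinear_bound {R : realType} (E k c a : R) : 0 <= c -> 0 <= a -> a < 1 -> `|k| <= 1 ->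
  exists K : R, forall G P : R, 0 <= P -> (0 < G -> P <= c * G `^ a) -> G - k * P = E ->
    G <= K.
Proof.
move=> c0 a0 a1 k1; have a1' : 0 < 1 - a by rewrite subr_gt0.
exists (1 + (`|E| + c) `^ (1 - a)^-1) => G P P0 Pb GE.
have [G1|G1] := leP G 1; first by rewrite (le_trans G1)// lerDl powR_ge0.
have G0 : 0 < G := lt_trans ltr01 G1.
have Ga : 1 <= G `^ a by rewrite -[leLHS](powRr0 G); apply: ler_powR => //; exact: ltW.
have GA : G <= (`|E| + c) * G `^ a.
  have h1 : E <= `|E| * G `^ a by rewrite (le_trans (ler_norm _))// ler_peMr.
  have h2 : k * P <= c * G `^ a.
    apply: le_trans (Pb G0); rewrite (le_trans (ler_norm _))// normrM (ger0_norm P0).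
    by rewrite ler_piMl.
  by rewrite mulrDl; move: GE h1 h2; lra.
have G1a : G `^ (1 - a) <= `|E| + c.
  rewrite -(ler_pM2r (lt_le_trans ltr01 Ga)) -powRD; last by rewrite (gt_eqF G0) implybT.
  by rewrite subrK powRr1 ?(ltW G0).
have -> : G = (G `^ (1 - a)) `^ (1 - a)^-1.
  by rewrite -powRrM mulfV ?gt_eqF// powRr1// ltW.
rewrite ler_wpDl// ge0_ler_powR ?nnegrE ?powR_ge0 ?addr_ge0//.
by rewrite invr_ge0 ltW.
Qed.

Section solution.
Context {R : realType}.
Local Notation lam := (@lebesgue_measure R).
Local Notation L := (LfunType lam (@one_le2E R)).
Local Notation V := (L * L)%type.
Local Notation sn := (seminorm (ip := ip)).
Implicit Types (v w : V) (F G : R -> R[i]) (phi : R -> R) (s t r : R).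

Definition mulV phi v : V := (toL (fun x => phi x * v.1 x), toL (fun x => phi x * v.2 x)).

Section bounded_multiplier.
Context {phi : R -> R} {M : R}.
Hypotheses (mphi : measurable_fun setT phi) (phiM : forall x, `|phi x| <= M).

Lemma mulV1E v : ((mulV phi v).1 : R -> R) = (fun x => phi x * v.1 x).
Proof. by rewrite /= toLE//; exact: Lfun2_boundedM phiM (LfunTP _). Qed.

Lemma mulV2E v : ((mulV phi v).2 : R -> R) = (fun x => phi x * v.2 x).
Proof. by rewrite /= toLE//; exact: Lfun2_boundedM phiM (LfunTP _). Qed.

Lemma mulVB v w : mulV phi (v - w) = mulV phi v - mulV phi w.
Proof.
rewrite [LHS]surjective_pairing; congr (_, _); apply/LfuneqP => x.
  rewrite mulV1E; transitivity ((mulV phi v).1 x - (mulV phi w).1 x) => //.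
  by rewrite !mulV1E; exact: mulrBr.
rewrite mulV2E; transitivity ((mulV phi v).2 x - (mulV phi w).2 x) => //.
by rewrite !mulV2E; exact: mulrBr.
Qed.

Lemma ip_mulV v w : ip (mulV phi v) w = ip v (mulV phi w).
Proof. by apply: eq_Rintegral => x _; rewrite !mulV1E !mulV2E; ring. Qed.

Lemma multiplier_bound_ge0 : 0 <= M. Proof. exact: le_trans (phiM 0). Qed.

Lemma seminorm_mulV v : sn (mulV phi v) <= M * sn v.
Proof.
have M0 := multiplier_bound_ge0; rewrite -[M in leRHS]ger0_norm// -sqrtr_sqr -sqrtrM ?sqr_ge0//.
apply: ler_wsqrtr; rewrite /ip -RintegralZl//; last exact: integrable_ip.
apply: le_Rintegral => //; [exact: integrable_ip|by apply: integrableZ_EFin; exact: integrable_ip|].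
move=> x _; rewrite mulV1E mulV2E.
have -> : phi x * v.1 x * (phi x * v.1 x) + phi x * v.2 x * (phi x * v.2 x) =
  phi x ^+ 2 * (v.1 x * v.1 x + v.2 x * v.2 x) by ring.
apply: ler_wpM2r; last exact: sqr_le_of_norm.
by rewrite -!expr2 addr_ge0// sqr_ge0.
Qed.

Lemma cvg_mulV (X : R -> V) t : sn (X s - X t) @[s --> t] --> 0 ->
  sn (mulV phi (X s) - mulV phi (X t)) @[s --> t] --> 0.
Proof.
move=> cX; apply: (@squeeze_cvgr _ _ _ _ (cst 0) (fun s => M * sn (X s - X t))).
- by near=> s; rewrite -mulVB sqrtr_ge0 seminorm_mulV.
- exact: cvg_cst.
- rewrite -[X in _ --> X](mulr0 M); exact: cvgM (cvg_cst _) cX.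
Unshelve. all: by end_near. Qed.

End bounded_multiplier.

(** * Conservation laws and the gradient bound *)

Context {p eps : R} {u : R -> R -> R[i]}.
Hypotheses (p1 : 1 < p) (p5 : p < 5) (eps1 : `|eps| = 1)
  (cu : continuous_H1 u) (sol : solves_NLS eps p u).

Let U t : V := toV (u t).
Let D t : V := toV (wderiv (u t)).
Let N t : V := toV (fun x => power_nonlinearity p (u t x)).

Lemma solution_H1 t : 0 <= t -> H1 (u t). Proof. by have [h _] := cu; exact: h. Qed.

Lemma solution_L2 t : 0 <= t -> L2 (u t). Proof. by move=> /solution_H1[]. Qed.

Lemma nonlinearity_solution_L2 t : 0 <= t -> L2 (fun x => power_nonlinearity p (u t x)).
Proof. by move=> /solution_H1; exact: nonlinearity_H1_L2. Qed.

Lemma solution_derivative t : 0 < t -> weak_derivative2 (U t) (D t).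
Proof. by move=> /ltW/solution_H1; exact: weak_derivative2_wderiv. Qed.

Lemma is_derive_ip_U t w w' : 0 < t -> weak_derivative2 w w' ->
  is_derive t 1 (fun s => ip (U s) w) (ip (D t) (rot w') - eps * ip (N t) (rot w)).
Proof.
move=> t0 ww'; apply: is_derive_ip_solution => //; first exact: solution_H1.
by apply: nonlinearity_solution_L2; exact: ltW.
Qed.

Lemma solution_continuous t : 0 < t -> sn (U s - U t) @[s --> t] --> 0.
Proof. by move=> t0; exact: (continuous_H1_seminorm _ _ cu t0).1. Qed.

Lemma gradient_continuous t : 0 < t -> sn (D s - D t) @[s --> t] --> 0.
Proof. by move=> t0; exact: (continuous_H1_seminorm _ _ cu t0).2. Qed.

(** Continuity in H^1 bounds the H^1 norm near t, hence the sup norm, by one constant; this makes a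
    single Lipschitz constant of the nonlinearity valid near t. *)
Lemma near_bounded t : 0 < t -> exists M : R, \forall s \near t,
  0 < s /\ {ae lam, forall x, Normc.normc (u s x) <= M}.
Proof.
move=> t0; exists (Num.sqrt (2 * (sn (U t) + 1) ^+ 2 + 4 * (sn (D t) + 1) ^+ 2)).
have bnd (X : R -> V) s : sn (X s - X t) <= 1 -> ip (X s) (X s) <= (sn (X t) + 1) ^+ 2.
  move=> h; rewrite -[leLHS]sqr_sqrtr ?ip_self_ge0//.
  rewrite lerXn2r ?nnegrE ?addr_ge0 ?sqrtr_ge0//.
  rewrite -[X in ip X X](subrK (X t)) addrC.
  by rewrite (le_trans (seminormD ip_sym ip_addl ip_scalel ip_self_ge0 _ _))// lerD.
have nU := near_seminorm U _ _ ltr01 (solution_continuous _ t0).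
have nD := near_seminorm D _ _ ltr01 (gradient_continuous _ t0).
move: (lt_nbhsr t0) nU nD; apply: filterS3 => s s0 /bnd h1 /bnd h2.
split => //; have := H1_bounded _ (solution_H1 _ (ltW s0)).
apply: filterS => x /le_trans; apply; apply: ler_wsqrtr.
by apply: lerD; [exact: ler_wpM2l h1|exact: ler_wpM2l h2].
Qed.

Lemma seminorm_nonlinearity_near_lipschitz t : 0 < t -> exists2 K : R, 0 <= K & \forall s \near t & r \near t,
  sn (N s - N r) <= K * sn (U s - U r).
Proof.
move=> t0; have [M hM] := near_bounded _ t0.
pose K := (2 + 2 * p ^+ 2) * (M `^ (p - 1)) ^+ 2.
have K0 : 0 <= K by rewrite mulr_ge0 ?sqr_ge0// addr_ge0// mulr_ge0// sqr_ge0.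
exists (Num.sqrt K); first exact: sqrtr_ge0.
exists ([set s | 0 < s /\ {ae lam, forall x, Normc.normc (u s x) <= M}],
  [set s | 0 < s /\ {ae lam, forall x, Normc.normc (u s x) <= M}]) => //=.
move=> [s r]/= [[s0 sM] [r0 rM]].
rewrite /seminorm -sqrtrM//; apply: ler_wsqrtr.
exact: (ip_nonlinearity_lipschitz _ _ _ _ p1 (solution_L2 _ (ltW s0)) (solution_L2 _ (ltW r0)) sM rM).
Qed.

Lemma nonlinearity_continuous t : 0 < t -> sn (N s - N t) @[s --> t] --> 0.
Proof.
move=> t0; have [K K0 [[P Q]/= [tP tQ] PQ]] := seminorm_nonlinearity_near_lipschitz _ t0.
apply: (@squeeze_cvgr _ _ _ _ (cst 0) (fun s => K * sn (U s - U t))).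
- near=> s; rewrite sqrtr_ge0/=; apply: (PQ (s, t)); split; first by near: s.
  exact: nbhs_singleton.
- exact: cvg_cst.
- rewrite -[X in _ --> X](mulr0 K); exact: cvgM (cvg_cst _) (solution_continuous _ t0).
Unshelve. all: by end_near. Qed.

Lemma nonlinearity_near_lipschitz t : 0 < t -> exists K : R, \forall s \near t & r \near t,
  ip (N s - N r) (U s - U r) <= K * ip (U s - U r) (U s - U r).
Proof.
move=> t0; have [K K0 h] := seminorm_nonlinearity_near_lipschitz _ t0; exists K.
apply: filterS h => -[s r] /= h.
rewrite (le_trans (ler_norm _))// (le_trans (cauchy_schwarz ip_sym ip_addl ip_scalel ip_self_ge0 _ _))//.
rewrite -[X in _ <= _ * X]sqr_sqrtr ?ip_self_ge0// expr2 mulrA.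
by rewrite ler_wpM2r// sqrtr_ge0.
Qed.

Lemma nonlinearity_solution_young s r : 0 < s -> 0 < r ->
  ip (N s) (U r) <= p / (p + 1) * ip (N s) (U s) + (p + 1)^-1 * ip (N r) (U r).
Proof.
move=> s0 r0; apply: ip_nonlinearity_young => //; try exact: nonlinearity_solution_L2 (ltW _).
- exact: solution_L2 (ltW _).
- exact: solution_L2 (ltW _).
Qed.

Lemma energy_conservation t : 0 < t ->
  ip (D t) (D t) - eps * (2 / (p + 1)) * ip (N t) (U t) =
  ip (D 1) (D 1) - eps * (2 / (p + 1)) * ip (N 1) (U 1).
Proof.
move=> t0; exact: (energy_constant ip_sym ip_addl ip_scalel ip_self_ge0 rotK ip_rot
  weak_derivative2B weak_derivative2_rot solution_derivative is_derive_ip_U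
  solution_continuous gradient_continuous nonlinearity_continuous p1
  nonlinearity_near_lipschitz nonlinearity_solution_young _ _ t0 ltr01).
Qed.

(** Gauge invariance: pointwise the nonlinearity is a real multiple of u and [phi] is real, so N
    conj(i phi u) is purely imaginary. *)
Lemma ip_rot_nonlinearity phi M t : 0 < t -> measurable_fun setT phi ->
  (forall x, `|phi x| <= M) -> ip (N t) (rot (mulV phi (U t))) = 0.
Proof.
move=> t0 mphi phiM; have N2 := nonlinearity_solution_L2 _ (ltW t0).
have U2 := solution_L2 _ (ltW t0).
rewrite /ip (_ : (fun x => _) = cst 0); first by rewrite Rintegral_cst// mul0r.
apply/funext => x.
change ((N t).1 x * - (mulV phi (U t)).2 x + (N t).2 x * (mulV phi (U t)).1 x = 0).
rewrite (mulV1E mphi phiM) (mulV2E mphi phiM) /N /U !toV1E// !toV2E// nonlinearity_Re nonlinearity_Im.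
ring.
Qed.

(** The virial lemma is used with W = phi U and W' = phi' U + phi D. The nonlinear term vanishes by
    [ip_rot_nonlinearity], and phi D pairs with D to the real part of an imaginary quantity, so only
    phi' U remains. *)
Lemma is_derive_weighted_mass phi phi' M M' t : smooth phi ->
  (forall x, is_derive (x : R) 1 phi (phi' x)) ->
  (forall x, `|phi x| <= M) -> (forall x, `|phi' x| <= M') -> 0 < t ->
  is_derive t 1 (fun s => ip (U s) (mulV phi (U s)))
    (2 * ip (D t) (rot (mulV phi' (U t)))).
Proof.
move=> sphi dphi phiM phiM' t0.
have phiE : phi' = derive1 phi.
  by apply/funext => x; rewrite derive1E; apply/esym; apply: derive_val.
have mphi : measurable_fun setT phi by apply: continuous_measurable_fun; exact: smooth_continuous.
have mphi' : measurable_fun setT phi'.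
  by rewrite phiE; apply: continuous_measurable_fun; exact/smooth_continuous/smooth_derive1.
pose W s := mulV phi (U s); pose W' s := mulV phi' (U s) + mulV phi (D s).
have := is_derive_virial ip_sym ip_addl ip_scalel ip_self_ge0 rotB rotK ip_rot
  is_derive_ip_U gradient_continuous nonlinearity_continuous W W' _ t0.
rewrite (ip_rot_nonlinearity _ _ _ t0 mphi phiM) mulr0 subr0.
have -> : ip (D t) (rot (W' t)) = ip (D t) (rot (mulV phi' (U t))).
  rewrite -[mulV phi' (U t)](addrK (mulV phi (D t))) -/(W' t) rotB [RHS]ip_sym.
  rewrite ip_addl -scaleN1r ip_scalel ip_sym [X in _ + _ * X](_ : _ = 0) ?mulr0 ?addr0//.
  rewrite /ip (_ : (fun x => _) = cst 0); first by rewrite Rintegral_cst// mul0r.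
  apply/funext => x.
  change (- (mulV phi (D t)).2 x * (D t).1 x + (mulV phi (D t)).1 x * (D t).2 x = 0).
  rewrite (mulV1E mphi phiM) (mulV2E mphi phiM); ring.
apply.
- move=> s /solution_derivative [h1 h2].
  have e1 : ((W' s).1 : R -> R) = (fun x => phi' x * (U s).1 x + phi x * (D s).1 x).
    apply/funext => x; transitivity ((mulV phi' (U s)).1 x + (mulV phi (D s)).1 x) => //.
    by rewrite (mulV1E mphi' phiM') (mulV1E mphi phiM).
  have e2 : ((W' s).2 : R -> R) = (fun x => phi' x * (U s).2 x + phi x * (D s).2 x).
    apply/funext => x; transitivity ((mulV phi' (U s)).2 x + (mulV phi (D s)).2 x) => //.
    by rewrite (mulV2E mphi' phiM') (mulV2E mphi phiM).
  split.
    rewrite (mulV1E mphi phiM) e1.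
    exact: (weak_derivativeM _ _ _ _ _ _ sphi dphi phiM phiM' (LfunTP _) (LfunTP _) h1).
  rewrite (mulV2E mphi phiM) e2.
  exact: (weak_derivativeM _ _ _ _ _ _ sphi dphi phiM phiM' (LfunTP _) (LfunTP _) h2).
- by move=> s r; rewrite -(ip_mulV mphi phiM) ip_sym.
- by apply: (cvg_mulV mphi phiM); exact: solution_continuous.
- have c1 := cvg_mulV mphi' phiM' _ _ (solution_continuous _ t0).
  have c2 := cvg_mulV mphi phiM _ _ (gradient_continuous _ t0).
  apply: (@squeeze_cvgr _ _ _ _ (cst 0) (fun s => sn (mulV phi' (U s) - mulV phi' (U t)) +
     sn (mulV phi (D s) - mulV phi (D t)))).
  + near=> s; rewrite sqrtr_ge0/=.
    have -> : W' s - W' t = (mulV phi' (U s) - mulV phi' (U t)) + (mulV phi (D s) - mulV phi (D t)).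
      by rewrite /W' opprD addrACA.
    exact: (seminormD ip_sym ip_addl ip_scalel ip_self_ge0).
  + exact: cvg_cst.
  + rewrite -[X in _ --> X](addr0 0); exact: cvgD c1 c2.
Unshelve. all: by end_near. Qed.

Lemma smooth_cst (c : R) : smooth (cst c).
Proof.
apply: (@smooth_coind _ (fun h => exists c, h = cst c)); last by exists c.
move=> _ [k ->]; exists (cst 0); first by exists 0.
by move=> x; exact: is_derive_cst.
Qed.

Lemma mass_conservation t : 0 < t -> ip (U t) (U t) = ip (U 1) (U 1).
Proof.
move=> t0; apply: (@eq_of_is_derive0 _ (fun t => ip (U t) (U t))) => // s s0.
have b1 x : `|(cst 1 : R -> R) x| <= 1 by rewrite normr1.
have b0 x : `|(cst 0 : R -> R) x| <= 0 by rewrite normr0.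
have := @is_derive_weighted_mass (cst 1) (cst 0) 1 0 s (smooth_cst 1)
  (fun x => is_derive_cst _ _ _) b1 b0 s0.
have -> : ip (D s) (rot (mulV (cst 0) (U s))) = 0.
  rewrite /ip (_ : (fun x => _) = cst 0); first by rewrite Rintegral_cst// mul0r.
  apply/funext => x.
  change ((D s).1 x * - (mulV (cst 0) (U s)).2 x + (D s).2 x * (mulV (cst 0) (U s)).1 x = 0).
  rewrite (mulV1E (measurable_cst _) b0) (mulV2E (measurable_cst _) b0) /=; ring.
rewrite mulr0; congr is_derive; apply/funext => r.
apply: eq_Rintegral => x _.
by rewrite (mulV1E (measurable_cst _) b1) (mulV2E (measurable_cst _) b1) /= !mul1r.
Qed.

Lemma ip_nonlinearity_ge0 t : 0 < t -> 0 <= ip (N t) (U t).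
Proof.
move=> t0; have N2 := nonlinearity_solution_L2 _ (ltW t0).
have U2 := solution_L2 _ (ltW t0).
apply: Rintegral_ge0 => x _.
rewrite /N /U !toV1E// !toV2E// nonlinearity_Re nonlinearity_Im -!mulrA -mulrDr -!expr2.
by rewrite mulr_ge0 ?powR_ge0// addr_ge0 ?sqr_ge0.
Qed.

(* Gagliardo-Nirenberg: the potential energy is controlled by the kinetic
   energy to the power [(p - 1) / 4 < 1]. *)
Lemma potential_bound t : 0 < t -> 0 < ip (D t) (D t) ->
  ip (N t) (U t) <= (2 * ip (U 1) (U 1) + 4) `^ ((p - 1) / 2) *
    ip (D t) (D t) `^ ((p - 1) / 4) * ip (U 1) (U 1).
Proof.
move=> t0; set G := ip (D t) (D t) => G0.
have sG : 0 < Num.sqrt G by rewrite sqrtr_gt0.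
(* This averaging length balances the sup bound: both of its terms become multiples of the square
   root of [G]. *)
have l0 : 0 < (Num.sqrt G)^-1 by rewrite invr_gt0.
have hs := solution_H1 _ (ltW t0).
have := H1_sup _ _ hs l0; rewrite -/(U t) -/(D t) -/G mass_conservation//.
set m := ip (U 1) (U 1).
have m0 : 0 <= m by exact: ip_self_ge0.
have -> : 2 / (Num.sqrt G)^-1 * m + 4 * (Num.sqrt G)^-1 * G = (2 * m + 4) * Num.sqrt G.
  rewrite -[X in _ + _ * X](sqr_sqrtr (ltW G0)); field.
  by rewrite gt_eqF.
have [U2 N2] := (solution_L2 _ (ltW t0), nonlinearity_solution_L2 _ (ltW t0)).
move=> h; have := ip_nonlinearity_pot _ _ _ p1 U2 N2 h.
rewrite -/(N t) -/(U t) mass_conservation// -/m => /le_trans; apply.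
rewrite ler_wpM2r// powRM ?sqrtr_ge0//; last by rewrite addr_ge0// mulr_ge0.
rewrite ler_wpM2l ?powR_ge0// -powR12_sqrt ?(ltW G0)// -powRrM.
by rewrite (_ : 2^-1 * ((p - 1) / 2) = (p - 1) / 4)//; field.
Qed.

Lemma gradient_bound : exists K : R, forall t, 0 < t -> ip (D t) (D t) <= K.
Proof.
have a0 : 0 <= (p - 1) / 4 by rewrite divr_ge0// subr_ge0 ltW.
(* This is where p < 5 enters: the potential is sublinear in the squared gradient norm. *)
have a1 : (p - 1) / 4 < 1 by rewrite ltr_pdivrMr// mul1r ltrBlDr (lt_le_trans p5)// -natr1.
have pp : 0 < p + 1 by rewrite addr_gt0// (lt_trans _ p1).
have k1 : `|eps * (2 / (p + 1))| <= 1.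
  rewrite normrM eps1 mul1r ger0_norm ?divr_ge0 ?(ltW pp)// ler_pdivrMr// mul1r.
  by rewrite -lerBlDr (le_trans _ (ltW p1))// lerBlDr -natr1.
have c0 : 0 <= (2 * ip (U 1) (U 1) + 4) `^ ((p - 1) / 2) * ip (U 1) (U 1).
  by apply: mulr_ge0; [exact: powR_ge0|exact: ip_self_ge0].
have [K hK] := sublinear_bound (ip (D 1) (D 1) - eps * (2 / (p + 1)) * ip (N 1) (U 1)) _ _ _ c0 a0 a1 k1.
exists K => t t0; apply: (hK _ (ip (N t) (U t))).
- exact: ip_nonlinearity_ge0.
- by rewrite mulrAC; exact: potential_bound.
- exact: energy_conservation.
Qed.

(** * Spatial cutoffs and the tail at time 1 *)

Lemma cutoff : exists C : R, forall rho : R, 0 < rho -> exists phi phi' : R -> R,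
  [/\ smooth phi, forall x, is_derive (x : R) 1 phi (phi' x),
      forall x, `|phi' x| <= C / rho,
      forall x, 0 <= phi x <= 2 &
      (forall x, `|x| <= rho / 2 -> phi x = 0) /\ (forall x, rho <= `|x| -> 1 <= phi x)].
Proof.
have [S [S' [C [sS dS S0 S1 [S01 S'C S'0]]]]] := @smooth_step R.
exists (8 * C) => rho rho0.
(* With this slope, k |x| - 3 is at most -1 for |x| <= rho / 2 and at least 1 for |x| >= rho, the
   thresholds of [S]. The two steps, one for each half-line, give 8 C / rho. *)
have [k kE] : exists k, k = 4 / rho by exists (4 / rho).
have k0 : 0 < k by rewrite kE divr_gt0.
pose phi x := 1 * S (k * x + -3) + 1 * S (- k * x + -3).
pose phi' x := k * S' (k * x + -3) + - k * S' (- k * x + -3).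
have d c x : is_derive (x : R) 1 (fun x => 1 * S (c * x + -3)) (c * S' (c * x + -3)).
  have d1 := is_derive_affine c (-3) x.
  have := @is_derive1_comp _ S (fun x => c * x + -3) x _ _ (dS _) d1.
  rewrite mulrC; congr is_derive; apply/funext => y /=; by rewrite mul1r.
exists phi, phi'; split.
- exact: smoothD (smooth_affine _ 1 k (-3) sS) (smooth_affine _ 1 (- k) (-3) sS).
- by move=> x; exact: is_deriveD (d k x) (d (- k) x).
- move=> x; rewrite (le_trans (ler_normD _ _))// !normrM normrN (gtr0_norm k0).
  have /andP[? ?] := S'C (k * x + -3); have /andP[? ?] := S'C (- k * x + -3).
  rewrite !ger0_norm//.
  have -> : 8 * C / rho = k * C + k * C by rewrite kE; field; rewrite gt_eqF.
  by apply: lerD; apply: ler_wpM2l => //; exact: ltW.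
- move=> x; have /andP[? ?] := S01 (k * x + -3); have /andP[? ?] := S01 (- k * x + -3).
  by rewrite /phi !mul1r; apply/andP; split; lra.
have {}kE : k * rho = 4 by rewrite kE divfK// gt_eqF.
split=> x.
- rewrite ler_norml => /andP[x1 x2].
  have h1 := ler_wpM2l (ltW k0) x1; have h2 := ler_wpM2l (ltW k0) x2.
  by rewrite /phi !S0 ?mulr0 ?addr0//; nra.
- rewrite /phi !mul1r ler_normr => /orP[] x1; have h1 := ler_wpM2l (ltW k0) x1.
    by rewrite S1 ?lerDl; [have /andP[] := S01 (- k * x + -3)|lra].
  by rewrite addrC S1 ?lerDl; [have /andP[] := S01 (k * x + -3)|lra].
Qed.

Lemma measurable_norm_ge (a : R) : measurable [set x : R | a <= `|x|].
Proof.
have mn : measurable_fun setT (fun x : R => `|x|) by exact: measurableT_comp.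
have -> : [set x : R | a <= `|x|] = setT `&` (fun x : R => `|x|) @^-1` `[a, +oo[%classic.
  by rewrite setTI; apply/seteqP; split => x /=; rewrite in_itv/= andbT.
exact: mn measurableT _ (measurable_itv _).
Qed.

(** Dominated convergence: at each point the indicators are eventually 0. *)
Lemma integrable_tail (h : R -> R) e : lam.-integrable setT (EFin \o h) -> 0 < e ->
  exists n : nat, \int[lam]_x (\1_[set x | n%:R <= `|x|] x * `|h x|) <= e.
Proof.
move=> ih e0; have mh := integrable_measurable _ ih.
pose f (n : nat) x := (\1_[set x | n%:R <= `|x|] x * `|h x|)%:E : \bar R.
have [|||||_ _] := @dominated_convergence _ _ R lam setT measurableT f (cst 0%E) (fun x => `|h x|%:E).
- move=> n; apply/measurable_EFinP; apply: measurable_funM; last exact: measurableT_comp.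
  by apply: measurable_indic; exact: measurable_norm_ge.
- exact: measurable_cst.
- apply: aeW => x _; apply: cvg_near_cst; near=> n.
  rewrite /f indicE memNset ?mul0r//= => xn; have : `|x| < n%:R.
    by near: n; exact: nbhs_infty_gtr.
  by rewrite ltNge xn.
- exact: integrable_norm.
- apply: aeW => x n _; rewrite /f/= lee_fin normrM normr_id ler_piMl//.
  by rewrite indicE; case: (x \in _); rewrite ?normr1 ?normr0.
rewrite integral0 => cvg0.
have := near_lt_of_cvge0 _ _ cvg0 e0; move=> [n _ /(_ n (leqnn n))] /= fn.
exists n; rewrite -lee_fin /Rintegral fineK ?ltW//.
have f0 : (0 <= \int[lam]_x f n x)%E.
  by apply: integral_ge0 => x _; rewrite lee_fin mulr_ge0// indicE.
by rewrite ge0_fin_numE// (lt_trans fn)// ltry.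
Unshelve. all: by end_near. Qed.

Lemma weighted_mass_tail e : 0 < e -> exists rho0 : R, forall rho phi,
  rho0 <= rho -> measurable_fun setT phi -> (forall x, 0 <= phi x <= 2) ->
  (forall x, `|x| <= rho / 2 -> phi x = 0) ->
  ip (U 1) (mulV phi (U 1)) <= e.
Proof.
move=> e0; have e20 : 0 < e / 2 by rewrite divr_gt0.
have [n hn] := integrable_tail _ _ (integrable_ip (U 1) (U 1)) e20.
(* Then |x| < n implies |x| <= rho / 2, so the weight, being at most 2, is dominated by twice the
   indicator of |x| >= n. *)
exists (2 * n%:R + 1) => rho phi rho0 mphi phi2 phi0.
have phiM x : `|phi x| <= 2 by have /andP[? ?] := phi2 x; rewrite ger0_norm.
apply: (@le_trans _ _ (2 * (e / 2))); last by rewrite mulrCA divff ?mulr1.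
apply: le_trans (ler_wpM2l _ hn) => //.
have im : lam.-integrable setT (EFin \o (fun x => \1_[set x | n%:R <= `|x|] x *
    `|(U 1).1 x * (U 1).1 x + (U 1).2 x * (U 1).2 x|)).
  apply: (integrable_dominated _ _ _ (integrable_ip (U 1) (U 1))).
    apply: measurable_funM; first by apply: measurable_indic; exact: measurable_norm_ge.
    by apply: measurableT_comp => //; exact: integrable_measurable (integrable_ip _ _).
  apply: aeW => x; rewrite normrM normr_id [X in _ * X]ger0_norm; last first.
    by rewrite -!expr2 addr_ge0 ?sqr_ge0.
  rewrite ler_piMl ?addr_ge0 -?expr2 ?sqr_ge0//.
  by rewrite indicE; case: (x \in _); rewrite ?normr1 ?normr0.
rewrite -RintegralZl//; apply: le_Rintegral => //.
- exact: integrable_ip.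
- exact: integrableZ_EFin.
move=> x _; rewrite (mulV1E mphi phiM) (mulV2E mphi phiM).
have -> : (U 1).1 x * (phi x * (U 1).1 x) + (U 1).2 x * (phi x * (U 1).2 x) =
  phi x * ((U 1).1 x * (U 1).1 x + (U 1).2 x * (U 1).2 x) by ring.
have q0 : 0 <= (U 1).1 x * (U 1).1 x + (U 1).2 x * (U 1).2 x.
  by rewrite -!expr2 addr_ge0 ?sqr_ge0.
rewrite ger0_norm// mulrA; apply: ler_wpM2r => //.
have [xn|xn] := leP n%:R `|x|.
  by rewrite indicE mem_set// mulr1; have /andP[] := phi2 x.
rewrite phi0 ?mulr_ge0//.
by move: xn rho0; lra.
Qed.

End solution.

Theorem corollary1p3 (R : realType) (p : R) (hp1 : 1 < p) (hp5 : p < 5)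
  (eps : R) (heps : eps = 1 \/ eps = -1)
  (u0 : R -> R[i]) (hu0 : H1 u0)
  (u : R -> R -> R[i]) (hu : continuous_H1 u) (hNLS : solves_NLS eps p u)
  (hinit : {ae @lebesgue_measure R, forall x, u 0 x = u0 x})
  (delta : R) (hdelta : 0 < delta)
  (mu : R -> R) (hmu_diff : forall t, derivable mu t 1)
  (hmu_C1 : continuous (derive1 mu))
  (hmu : exists2 c : R, 0 < c &
     forall t : R, 2 <= t -> c * (t * (ln t) `^ (1 + delta)) <= mu t)
  (c1 c2 : R) (hc1 : 0 < c1) (hc12 : c1 < c2) :
  L2norm [set x | c1 * mu t <= `|x| <= c2 * mu t] (u t) @[t --> +oo] --> 0%E.
Proof.
have eps1 : `|eps| = 1 by case: heps => ->; rewrite ?normrN normr1.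
have uL2 t : 0 <= t -> L2 (u t) by move=> t0; case: hu => /(_ t t0)[].
have mD (a b : R) : measurable [set x : R | a <= `|x| <= b].
  have mn : measurable_fun setT (fun x : R => `|x|) by exact: measurableT_comp.
  have -> : [set x : R | a <= `|x| <= b] = setT `&` (fun x : R => `|x|) @^-1` `[a, b]%classic.
    by rewrite setTI; apply/seteqP; split => x /=; rewrite in_itv.
  exact: mn measurableT _ (measurable_itv _).
pose I t := \int[@lebesgue_measure R]_x (\1_[set x | c1 * mu t <= `|x| <= c2 * mu t] x *
  (complex.Re (u t x) ^+ 2 + complex.Im (u t x) ^+ 2)).
(* [I t] is the square of the norm, hence the target [e ^+ 2]: one half is spent on the tail at time
   1, the other on the flux. *)
suff Icvg (e : R) : 0 < e -> \forall t \near +oo, I t <= e ^+ 2.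
  apply/fine_cvgP; split.
    near=> t; have t0 : 0 <= t by near: t; exact: nbhs_pinfty_ge.
    by rewrite L2normE//; exact: uL2.
  apply/cvgrPdist_le => e e0; near=> t.
  have t0 : 0 <= t by near: t; exact: nbhs_pinfty_ge.
  rewrite /= L2normE//; last exact: uL2.
  rewrite /= sub0r normrN ger0_norm ?sqrtr_ge0//.
  rewrite -[leRHS]ger0_norm ?(ltW e0)// -sqrtr_sqr; apply: ler_wsqrtr.
  by near: t; exact: Icvg.
move=> e0.
have [K hK] := gradient_bound hp1 hp5 eps1 hu hNLS.
have [C hC] := @cutoff R.
have e20 : 0 < e ^+ 2 / 2 by rewrite divr_gt0// exprn_gt0.
have [rho0 tail] := @weighted_mass_tail R u _ e20.
have [c c0 muc] := hmu.
pose m := ip (toV (u 1)) (toV (u 1)).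
(* [B / rho] will bound the derivative of the weighted mass: the factors are the gradient bound, the
   slope of the cutoff times rho, and the conserved L^2 norm. *)
pose B := 2 * (Num.sqrt K * (`|C| * Num.sqrt m)).
have B0 : 0 <= B by rewrite !mulr_ge0// sqrtr_ge0.
(* Once [t <= k * rho], the flux between times 1 and t is at most B k <= e^2 / 2. The threshold
   [Lam] for [ln t] is what makes c1 mu(t) >= c1 c t ln t reach t / k. *)
have [k kE] : exists k, k = e ^+ 2 / 2 / (B + 1) by eexists.
have k0 : 0 < k by rewrite kE divr_gt0// ltr_wpDl.
have [Lam LamE] : exists Lam, Lam = (k * (c1 * c))^-1 by eexists.
have cc0 : 0 < k * (c1 * c) := mulr_gt0 k0 (mulr_gt0 hc1 c0).
near=> t.
have t2 : 2 <= t by near: t; apply: nbhs_pinfty_ge; rewrite num_real.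
have t0 : 0 < t by rewrite (lt_le_trans _ t2).
have ln1 : 1 <= ln t.
  by rewrite -[leLHS](@expRK R) ler_ln ?posrE ?expR_gt0//.
have lnL : Lam <= ln t.
  by rewrite -[leLHS](@expRK R) ler_ln ?posrE ?expR_gt0//.
(* The scale is frozen at its value for the final time t, so the weight stays fixed while the
   solution evolves from time 1 to t. *)
pose rho := c1 * mu t.
have lnd : ln t <= ln t `^ (1 + delta).
  by rewrite -[leLHS]powRr1 ?(le_trans ler01)// ler_powR// lerDl ltW.
have trho : t <= k * rho.
  have h1 := muc t t2.
  have h2 : k * (c1 * (c * (t * Lam))) <= k * rho.
    rewrite !ler_wpM2l ?(ltW k0) ?(ltW hc1)//; apply: le_trans h1.
    by rewrite !ler_wpM2l ?(ltW c0) ?(ltW t0)// (le_trans lnL).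
  apply: le_trans h2; rewrite le_eqVlt; apply/orP; left; apply/eqP.
  rewrite LamE; field; rewrite ?gt_eqF//.
have rhop : 0 < rho by rewrite -(pmulr_rgt0 _ k0) (lt_le_trans t0).
have rho0t : rho0 <= rho.
  rewrite -(ler_pM2l k0) (le_trans _ trho)//; near: t; apply: nbhs_pinfty_ge; rewrite num_real.
have [phi [phi' [sphi dphi phi'C phi2 [phi0 phi1]]]] := hC _ rhop.
have mphi : measurable_fun setT phi.
  by apply: continuous_measurable_fun; exact: smooth_continuous.
have phiM x : `|phi x| <= 2 by have /andP[? ?] := phi2 x; rewrite ger0_norm.
have phi'M x : `|phi' x| <= `|C| / rho.
  rewrite (le_trans (phi'C x))// ler_wpM2r ?invr_ge0 ?(ltW rhop)//; exact: ler_norm.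
have mphi' : measurable_fun setT phi'.
  have -> : phi' = derive1 phi.
    by apply/funext => x; rewrite derive1E; apply/esym; apply: derive_val.
  by apply: continuous_measurable_fun; exact/smooth_continuous/smooth_derive1.
have V1 := tail rho phi rho0t mphi phi2 phi0.
pose W s := ip (toV (u s)) (mulV phi (toV (u s))).
have dW (s : R) : 0 < s -> is_derive s 1 W
    (2 * ip (toV (wderiv (u s))) (rot (mulV phi' (toV (u s))))).
  exact: (is_derive_weighted_mass hp1 hu hNLS _ _ _ _ _ sphi dphi phiM phi'M).
have IW : I t <= W t.
  have ut := uL2 _ (ltW t0).
  apply: le_Rintegral => //.
  - exact: integrable_indic_sqr.
  - exact: integrable_ip.
  move=> x _; rewrite (mulV1E mphi phiM) (mulV2E mphi phiM) toV1E// toV2E//.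
  rewrite [leRHS](_ : _ = phi x * (complex.Re (u t x) ^+ 2 + complex.Im (u t x) ^+ 2)); last by ring.
  rewrite ler_wpM2r ?addr_ge0 ?sqr_ge0// indicE; have [|] := boolP (x \in _); last first.
    by move=> _; have /andP[] := phi2 x.
  by rewrite inE/= => /andP[/phi1].
apply: (le_trans IW).
have [s /andP[sm _]|s /andP[sm _]] := @MVT_minmax R W
    (fun s => 2 * ip (toV (wderiv (u s))) (rot (mulV phi' (toV (u s))))) 1 t.
  by apply: dW; rewrite (lt_le_trans _ sm)// lt_min ltr01.
have s0 : 0 < s by rewrite (lt_le_trans _ sm)// lt_min ltr01.
move=> /(canRL (subrK _)) ->.
rewrite [leRHS]splitr lerD//.
have bnd : 2 * ip (toV (wderiv (u s))) (rot (mulV phi' (toV (u s)))) <= B / rho.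
  rewrite /B -!mulrA; apply: ler_wpM2l => //.
  rewrite (le_trans (ler_norm _))// (le_trans (cauchy_schwarz ip_sym ip_addl ip_scalel ip_self_ge0 _ _))//.
  rewrite (seminormJ ip_sym ip_scalel rotK ip_rot) ler_pM ?sqrtr_ge0//.
    by apply: ler_wsqrtr; exact: hK.
  rewrite (le_trans (seminorm_mulV mphi' phi'M _))//.
  rewrite /seminorm (mass_conservation hp1 hu hNLS _ s0) -/m.
  by rewrite le_eqVlt; apply/orP; left; apply/eqP; field; rewrite gt_eqF.
apply: (@le_trans _ _ (B / rho * (t - 1))); first by rewrite ler_wpM2r// subr_ge0 (le_trans _ t2)// ler1n.
have Br : 0 <= B / rho by rewrite divr_ge0// ltW.
apply: (@le_trans _ _ (B / rho * (k * rho))).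
  by rewrite ler_wpM2l// lerBlDr (le_trans trho)// lerDl.
have -> : B / rho * (k * rho) = B * k by field; rewrite gt_eqF.
rewrite kE mulrCA -[leRHS]mulr1 ler_wpM2l ?(ltW e20)//.
by rewrite ler_pdivrMr ?mul1r ?lerDl// ltr_wpDl.
Unshelve. all: by end_near. Qed.
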